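(* Let $L$ be a singular link with a double point $b$, and let $L_+$ and $L_-$ be the (possibly singular) links obtained from $L$ by resolving $b$ to a positive and a negative crossing, respectively. Then, for each $j\in\mathbb Z$, there is a long exact sequence $$\cdots\to\mathit{Kh}^{i-1,j}(L;\mathbb F_2)\to\mathit{Kh}^{i,j}(L_-;\mathbb F_2)\xrightarrow{\widehat\Phi}\mathit{Kh}^{i,j}(L_+;\mathbb F_2)\to\mathit{Kh}^{i,j}(L;\mathbb F_2)\to\cdots$$ where $\widehat\Phi$ is the map induced by the genus-$1$ map applied around $b$. (The groups are computed from a diagram $D$ of $L$ and the diagrams $D_+$, $D_-$ obtained from it by resolving $b$.)
   Context: All links and diagrams are oriented. A singular link is an immersion of finitely many oriented circles in $S^3$ whose only singularities are finitely many transverse double points, considered up to ambient isotopy; a singular link diagram is a generic plane projection with ordinary (over/under) crossings and marked double points. Frobenius algebra. $A=\mathbb Z[x]/(x^2)$ with the usual multiplication $\mu$ and comultiplication $\Delta(1)=x\otimes1+1\otimes x$, $\Delta(x)=x\otimes x$; grading $\deg 1=1$, $\deg x=-1$. For a closed $1$-manifold $W$, $Z_A(W)=A^{\otimes\pi_0(W)}$; a saddle cobordism acts by $\mu$ if it merges two circles and by $\Delta$ if it splits one circle. Khovanov complex of an ordinary diagram $D$. Let $c(D)$ be the set of crossings. The $0$-smoothing of a crossing joins the two regions swept out when the overstrand is rotated counterclockwise until it meets the understrand; the $1$-smoothing is the other one (so the orientation-respecting smoothing is the $0$-smoothing at a positive crossing and the $1$-smoothing at a negative crossing). A state is a subset $s\subset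 c(D)$, and $D_s$ is the result of $1$-smoothing the crossings in $s$ and $0$-smoothing the others. Put $\overline C^{i,j}(D)=\bigoplus_{|s|=i}Z_A(D_s)^{j-i}$ (superscript on $Z_A$: homogeneous degree), with $d=\sum_{c}\pm\delta_c$, where $\delta_c:Z_A(D_s)\to Z_A(D_{s\cup\{c\}})$ for $c\notin s$ is the saddle map, $\delta_c=0$ for $c\in s$, and the signs are the standard ones making $d^2=0$ (irrelevant mod $2$). With $n_\pm$ the numbers of positive/negative crossings, $C^{i,j}(D)=\overline C^{i+n_-,\,j+2n_--n_+}(D)$ with the same differential. Genus-$1$ map. Let $D_-$ be an ordinary diagram with a negative crossing $b$ and let $D_+$ be obtained by changing $b$ to a positive crossing. The orientation-respecting smoothing at $b$ is the $1$-smoothing for $D_-$ and the $0$-smoothing for $D_+$. The genus-$1$ map $\widehat\Phi_b:C(D_-)\otimes\mathbb F_2\to C(D_+)\otimes\mathbb F_2$ is the chain map of bidegree $(0,0)$ that is zero on the summands for states $s\not\ni b$, and for $s\ni b$ sends $Z_A((D_-)_s)\otimes\mathbb F_2$ to $Z_A((D_+)_{s\setminus\{b\}})\otimes\mathbb F_2$ (the same $1$-manifold) by the composition of the saddle at $b$ followed by the reverse saddle: if the two strands at $b$ lie on different circles labelled $p,q$ this is $p\otimes q\mapsto\Delta(pq)$, and if they lie on the same circle labelled $p$ it is $p\mapsto\mu(\Delta(p))$; it is the identity on the other tensor factors. Singular diagrams. For a singular link diagram $D$ with set $c^\sharp(D)$ of double points and $S\subset c^\sharp(D)$, let $D_S$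 be the ordinary diagram obtained by resolving the double points in $S$ to positive crossings and the others to negative crossings. The maps $\widehat\Phi_b:C(D_S)\otimes\mathbb F_2\to C(D_{S\cup\{b\}})\otimes\mathbb F_2$ ($b\notin S$) commute for distinct $b$. The Khovanov complex $C(D;\mathbb F_2)$ is the multiple mapping cone $$C^{i,j}(D;\mathbb F_2)=\bigoplus_{S\subset c^\sharp(D)}C^{\,i+|c^\sharp(D)\setminus S|,\,j}(D_S)\otimes\mathbb F_2,$$ whose differential is, on the $S$-summand, the sum of the differential of $C(D_S)\otimes\mathbb F_2$ and of all $\widehat\Phi_b$ with $b\in c^\sharp(D)\setminus S$ (signs are irrelevant in characteristic $2$). Put $\mathit{Kh}^{i,j}(D;\mathbb F_2)=H^i(C^{*,j}(D;\mathbb F_2))$; up to isomorphism it depends only on the singular link $L$ represented by $D$ and is written $\mathit{Kh}^{i,j}(L;\mathbb F_2)$. For a singular diagram $D$ with double point $b$ and resolutions $D_\pm$ of $b$, the genus-$1$ map around $b$, $\widehat\Phi:C(D_-;\mathbb F_2)\to C(D_+;\mathbb F_2)$, is the chain map given on the summand indexed by $S\subset c^\sharp(D)\setminus\{b\}$ by $\widehat\Phi_b:C(D_S)\otimes\mathbb F_2\to C(D_{S\cup\{b\}})\otimes\mathbb F_2$. *)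

(* Defs.v *)
From HB Require Import structures.
From mathcomp Require Import all_boot all_order perm all_algebra.

Set Implicit Arguments.
Unset Strict Implicit.
Unset Printing Implicit Defensive.

Import GRing.Theory.
Local Open Scope ring_scope.
Local Open Scope quotient_scope.

(** * Homology of U -f-> V -g-> W over a field *)

Section QuotientSpace.
Variables (K : fieldType) (V : vectType K) (U : {vspace V}).

Definition quotv := Quotient.quot (pred_of_vspace U).
HB.instance Definition _ := GRing.Zmodule.on quotv.

Definition quotv_class (v : V) : quotv := \pi_quotv v.

Definition quotv_scale (a : K) (x : quotv) : quotv := quotv_class (a *: repr x).

Lemma quotv_classE u v : (quotv_class u = quotv_class v) <-> (u - v \in U).
Proof.
by split=> [/eqP | uv]; last apply/eqP; rewrite -?Quotient.idealrBE // => ->.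
Qed.

Lemma quotv_class_surj (x : quotv) : exists v, x = quotv_class v.
Proof. by exists (repr x); rewrite /quotv_class reprK. Qed.

Lemma quotv_classD u v : quotv_class (u + v) = quotv_class u + quotv_class v.
Proof. exact: (@Quotient.pi_add V U). Qed.

Lemma quotv_classZ a v : quotv_class (a *: v) = quotv_scale a (quotv_class v).
Proof.
apply/quotv_classE; rewrite -scalerBr memvZ //.
by apply/quotv_classE; rewrite /quotv_class reprK.
Qed.

Fact quotv_scaleA a b x :
  quotv_scale a (quotv_scale b x) = quotv_scale (a * b) x.
Proof. by have [v ->] := quotv_class_surj x; rewrite -!quotv_classZ scalerA. Qed.
Fact quotv_scale1 : left_id 1 quotv_scale.
Proof. by move=> x; have [v ->] := quotv_class_surj x; rewrite -quotv_classZ scale1r. Qed.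
Fact quotv_scaleDr : right_distributive quotv_scale +%R.
Proof.
move=> a x y; have [u ->] := quotv_class_surj x.
have [v ->] := quotv_class_surj y.
by rewrite -quotv_classD -!quotv_classZ -quotv_classD scalerDr.
Qed.
Fact quotv_scaleDl x : {morph quotv_scale^~ x : a b / a + b}.
Proof.
move=> a b; have [v ->] := quotv_class_surj x.
by rewrite -!quotv_classZ -quotv_classD scalerDl.
Qed.
HB.instance Definition _ := GRing.Zmodule_isLmodule.Build K quotv
  quotv_scaleA quotv_scale1 quotv_scaleDr quotv_scaleDl.

End QuotientSpace.

Section Homology.
Variable K : fieldType.

Definition cycles (V W : vectType K) (g : 'Hom(V, W)) := subvs_of (lker g).

(* the image of f, seen inside the kernel of g *)
Definition boundaries (U V W : vectType K) (f : 'Hom(U, V)) (g : 'Hom(V, W)) :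
  {vspace cycles g} := (linfun vsval @^-1: limg f)%VS.

Definition homology (U V W : vectType K) (f : 'Hom(U, V)) (g : 'Hom(V, W)) :
  lmodType K := quotv (boundaries f g).

Definition hclass (U V W : vectType K) (f : 'Hom(U, V)) (g : 'Hom(V, W))
  (z : cycles g) : homology f g := quotv_class _ z.

(* [h] is the map induced on homology by the degree component [phi] of a chain
   map: [phi] sends each cycle [z] to a cycle, whose class is [h [z]]. *)
Definition induced_by (U V W U' V' W' : vectType K)
    (f : 'Hom(U, V)) (g : 'Hom(V, W)) (f' : 'Hom(U', V')) (g' : 'Hom(V', W'))
    (phi : 'Hom(V, V')) (h : homology f g -> homology f' g') : Prop :=
  forall z : cycles g, exists z' : cycles g',
    vsval z' = phi (vsval z) /\ h (hclass f z) = hclass f' z'.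

Definition exact_at (A B C : lmodType K) (f : A -> B) (g : B -> C) : Prop :=
  forall y : B, g y = 0 <-> exists x : A, f x = y.

End Homology.

Section MatrixMaps.
Variables I J : finType.

Definition coef_fun (M : I -> J -> 'F_2) (u : {ffun I -> ('F_2)^o}) :
  {ffun J -> ('F_2)^o} := [ffun h => \sum_g u g * M g h].

Fact coef_fun_linear M : linear (coef_fun M).
Proof.
move=> a u v; apply/ffunP=> h; rewrite !ffunE scaler_sumr -big_split /=.
by apply: eq_bigr => g _; rewrite !ffunE mulrDl scalerAl.
Qed.
HB.instance Definition _ M :=
  GRing.isLinear.Build 'F_2 {ffun I -> ('F_2)^o} {ffun J -> ('F_2)^o} _
    (coef_fun M) (coef_fun_linear M).

Definition coef_map (M : I -> J -> 'F_2) :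
  'Hom({ffun I -> ('F_2)^o}, {ffun J -> ('F_2)^o}) := linfun (coef_fun M).

Lemma coef_mapE M u h : coef_map M u h = \sum_g u g * M g h.
Proof. by rewrite lfunE /= ffunE. Qed.

End MatrixMaps.

(** * Oriented diagrams *)

(* Near a crossing or double point [v], rotate the plane so that both strands
   run upwards: the ends at [v] are NE, NW (outgoing) and SW, SE (incoming),
   and the strands are SW -> NE and SE -> NW.  An outgoing or incoming end is
   denoted by [(v, l)], with [l = true] for the left one (NW or SW).  The
   permutation [arc] sends the outgoing end where an edge starts to the
   incoming end where it stops.  Thus [arc] determines the oriented 4-valent
   graph with its counterclockwise cyclic order at each vertex. *)
Section Planarity.
Variables (V : finType) (arc : {perm V * bool}).

(* [(v, l, o)] is an end at [v], outgoing iff [o]. *)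
Definition dart := (V * bool * bool)%type.

Definition dart_flip (d : dart) : dart :=
  let: (e, o) := d in if o then (arc e, false) else ((arc^-1)%g e, true).

(* counterclockwise: NE -> NW -> SW -> SE -> NE *)
Definition dart_turn (d : dart) : dart :=
  let: (v, l, o) := d in (v, o, ~~ l).

Definition dart_face (d : dart) : dart := dart_turn (dart_flip d).

Definition dart_glink : rel dart :=
  [rel d d' | (d' == dart_flip d) || (d' == dart_turn d)].

(* Euler's formula V - E + F = 2c, where E = 2V and c is the number of connected
   components: every component of the graph is embedded in a sphere. *)
Definition planar : Prop :=
  (#|V| + fcard dart_face predT =
     #|{: V * bool}| + 2 * n_comp dart_glink predT)%N.

End Planarity.

(* [nloop] counts the components without crossings and double points.  The
   relative position in the plane of the connected components of a diagram is
   not recorded: it affects neither the link nor its complex. *)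
Record shadow := Shadow {
  vtx : finType;
  arc : {perm vtx * bool};
  nloop : nat;
  shadow_planar : planar arc
}.

(* At a positive crossing SW -> NE is the overstrand, at a negative crossing it
   is the understrand. *)
Record diagram := Diagram {
  dshadow :> shadow;
  positive : pred (vtx dshadow)
}.

Inductive vertex_kind := Positive | Negative | Double.

Record sing_diagram := SingDiagram {
  sshadow :> shadow;
  kind : vtx sshadow -> vertex_kind
}.

Definition double_points (D : sing_diagram) : {set vtx D} :=
  [set v | if kind v is Double then true else false].

(* D_P: double points in [P] become positive, the others negative *)
Definition resolve_all (D : sing_diagram) (P : {set vtx D}) : diagram :=
  @Diagram D (fun v => match kind v with
                       | Positive => true
                       | Negative => false
                       | Double => v \in P
                       end).

Definition resolve (D : sing_diagram) (b : vtx D) (k : vertex_kind) :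
  sing_diagram := @SingDiagram D (fun v => if v == b then k else kind v).

(** * Smoothings *)

Definition edge (G : shadow) := ((vtx G * bool) + 'I_(nloop G))%type.

Section Edges.
Variable G : shadow.
Definition out_edge (v : vtx G) (l : bool) : edge G := inl (v, l).
Definition in_edge (v : vtx G) (l : bool) : edge G := inl ((arc G)^-1%g (v, l)).
End Edges.

Definition state (D : diagram) := {set vtx D}.

(* The 0-smoothing is orientation-respecting exactly at positive crossings. *)
Definition oriented_at (D : diagram) (s : state D) (v : vtx D) : bool :=
  positive v (+) (v \in s).

Definition joined_at (D : diagram) (s : state D) (v : vtx D) : rel (edge D) :=
  [rel e f | if oriented_at s v
             then [exists l, (e == in_edge v l) && (f == out_edge v l)]
             else (e == in_edge v true) && (f == in_edge v false)
               || (e == out_edge v true) && (f == out_edge v false)].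

Definition joined (D : diagram) (s : state D) : rel (edge D) :=
  [rel e f | [exists v, joined_at s v e f || joined_at s v f e]].

(* [e] and [f] lie on the same circle of D_s. *)
Definition same_circle (D : diagram) (s : state D) : rel (edge D) :=
  connect (joined s).

(* The SW and NE ends at [v] lie on different strands of either smoothing. *)
Definition strand1 (D : diagram) (v : vtx D) : edge D := in_edge v true.
Definition strand2 (D : diagram) (v : vtx D) : edge D := out_edge v false.

(** * The Frobenius algebra A (mod 2) and the vector spaces Z_A(D_s) *)

(* The basis (1, x) of A is indexed by [bool], [true] standing for x. *)

(* coefficient of c in the product a b *)
Definition mu_coef (a b c : bool) : 'F_2 :=
  match a, b with
  | false, _ => (c == b)%:R
  | true, false => (c == true)%:R
  | true, true => 0
  end.

(* coefficient of b (x) c in Delta a *)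
Definition delta_coef (a b c : bool) : 'F_2 :=
  match a with
  | false => (b (+) c)%:R
  | true => (b && c)%:R
  end.

(* A basis of Z_A(D_s) is given by the labellings of the circles of D_s by 1 or
   x, that is, the labellings of the edges that are constant on circles. *)
Definition labelling (G : shadow) := {ffun edge G -> bool}.

Definition circle_labelling (D : diagram) (s : state D) (l : labelling D) :=
  [forall e, forall f, same_circle s e f ==> (l e == l f)].

Definition label_degree (D : diagram) (s : state D) (l : labelling D) : int :=
  (n_comp (joined s) [pred e | ~~ l e])%:Z
    - (n_comp (joined s) [pred e | l e])%:Z.

(** * The complex of an ordinary diagram *)

Definition npos (D : diagram) : nat := #|[set v | positive (d := D) v]|.
Definition nneg (D : diagram) : nat := #|[set v | ~~ positive (d := D) v]|.

Definition gen (G : shadow) := ({set vtx G} * labelling G)%type.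

(* basis of \overline C^{i,j}(D) *)
Definition ubasis (D : diagram) (i j : int) (x : gen D) : bool :=
  let: (s, l) := x in
  [&& #|s|%:Z == i, circle_labelling (D := D) s l
    & label_degree (D := D) s l == j - i].

(* basis of C^{i,j}(D) *)
Definition basis (D : diagram) (i j : int) : pred (gen D) :=
  ubasis (i + (nneg D)%:Z) (j + (2 * nneg D)%:Z - (npos D)%:Z).

(* [l] and [m] agree off the circles of D_s passing near [v] *)
Definition agree_off (D : diagram) (s : state D) (v : vtx D)
    (l m : labelling D) : bool :=
  [forall e, [|| same_circle s (strand1 v) e, same_circle s (strand2 v) e
                | l e == m e]].

(* The coefficient of the labelling [m] in the image of the labelling [l] by
   the saddle map Z_A(D_s) -> Z_A(D_{s'}), where s' is s with [c] added.  The
   saddle merges or splits circles because D is planar, so the final [else] is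
   never reached. *)
Definition saddle_coef (D : diagram) (s : state D) (c : vtx D)
    (l m : labelling D) : 'F_2 :=
  let s' : state D := c |: s in
  let p := strand1 c in
  let q := strand2 c in
  if ~~ agree_off s c l m then 0
  else if ~~ same_circle s p q then mu_coef (l p) (l q) (m p)
  else if ~~ same_circle s' p q then delta_coef (l p) (m p) (m q)
  else 0.

(* mod 2, so that the signs of the summands are irrelevant *)
Definition diff_coef (D : diagram) (x y : gen D) : 'F_2 :=
  let: (s, l) := x in
  let: (t, m) := y in
  \sum_(c | (c \notin s) && (t == c |: s)) saddle_coef (D := D) s c l m.

(* The coefficient of [y] in the image of [x] by the genus-1 map from
   D = D_- to D_+ at the negative crossing [b]. *)
Definition genus1_coef (D : diagram) (b : vtx D) (x y : gen D) : 'F_2 :=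
  let: (s, l) := x in
  let: (t, m) := y in
  let p := strand1 b in
  let q := strand2 b in
  if ~~ [&& b \in s, t == s :\ b & agree_off (D := D) s b l m] then 0
  else if ~~ same_circle (D := D) s p q then
    \sum_a mu_coef (l p) (l q) a * delta_coef a (m p) (m q)
  else
    \sum_a \sum_a' delta_coef (l p) a a' * mu_coef a a' (m p).

(** * The complex of a singular diagram *)

Definition sing_gen (D : sing_diagram) := ({set vtx D} * gen D)%type.

Definition sing_basis (D : sing_diagram) (i j : int) (g : sing_gen D) : bool :=
  let: (P, x) := g in
  (P \subset double_points D)
    && basis (D := resolve_all P) (i + #|double_points D :\: P|%:Z) j x.

Definition chain_basis (D : sing_diagram) (i j : int) :=
  {g : sing_gen D | sing_basis i j g}.

(* C^{i,j}(D; F_2) *)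
Definition chain (D : sing_diagram) (i j : int) :=
  {ffun chain_basis D i j -> ('F_2)^o}.

Definition sing_diff_coef (D : sing_diagram) (g h : sing_gen D) : 'F_2 :=
  let: (P, x) := g in
  let: (Q, y) := h in
  (Q == P)%:R * diff_coef (D := resolve_all P) x y
  + \sum_(b in double_points D :\: P | Q == b |: P)
      genus1_coef (D := resolve_all P) b x y.

(* The component C^{i,j} -> C^{i',j} of the differential; it vanishes unless
   i' = i + 1. *)
Definition differential (D : sing_diagram) (j i i' : int) :
    'Hom(chain D i j, chain D i' j) :=
  coef_map (fun g h => sing_diff_coef (val g) (val h)).

Definition Kh (D : sing_diagram) (i j : int) : lmodType 'F_2 :=
  homology (differential D j (i - 1) i) (differential D j i (i + 1)).

(* The genus-1 map around [b], from D_- to D_+; note that (D_-)_P = D_P and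
   (D_+)_P is D_(P + b) when b is not in P. *)
Definition sing_genus1_coef (D : sing_diagram) (b : vtx D)
    (g : sing_gen (resolve b Negative)) (h : sing_gen (resolve b Positive)) :
    'F_2 :=
  let: (P, x) := g in
  let: (Q, y) := h in
  (Q == P)%:R
    * genus1_coef (D := resolve_all (D := resolve b Negative) P) b x y.

Definition genus1_map (D : sing_diagram) (b : vtx D) (i j : int) :
    'Hom(chain (resolve b Negative) i j, chain (resolve b Positive) i j) :=
  coef_map (fun g h => sing_genus1_coef (val g) (val h)).

(* Main.v *)
Require Import Defs.
From mathcomp Require Import all_boot all_order perm all_algebra zify.
From Stdlib Require Import FunctionalExtensionality.
From HB Require Import structures.

(** The double point b splits the complex of D.  A generator of C(D) resolves
    b either to a positive crossing, and then it is a generator of C(D_+), or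
    to a negative one, and then it is a generator of C(D_-) whose degree is
    larger by one.  So C^i(D) = C^i(D_+) + C^(i+1)(D_-) with differential
    (x, y) |-> (d x + Phi y, d y), where Phi is the genus-1 map around b, and
    the long exact sequence is that of a mapping cone.  [cone_differentialP]
    identifies the complex with this cone, and [cone_exact_pos],
    [cone_exact_cone] and [cone_exact_neg] are exactness at its three terms, in
    terms of cycles and boundaries.

    It remains to see that Phi is a chain map ([genus1_map_chain]).  The point
    is that modulo 2 the genus-1 map at b is a multiplication operator.  If p
    and q are the strands at b, then Delta(p q) = Delta(1) p q, and
    Delta(1) = x (x) 1 + 1 (x) x, so on two distinct circles Phi multiplies by
    x_p + x_q, where x_e denotes multiplication by x on the circle of the edge
    e.  On a single circle Phi is mu(Delta(p)) = 2 x p = 0, which is again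
    (x_p + x_q) p ([genus1E]).  Three facts follow.

    - The multiplication and comultiplication of A are A-linear, so a saddle
      commutes with every x_e ([saddle_mulx], [saddle_comm_mulx]), hence with
      the genus-1 map at another crossing.
    - The operators x_e commute, so the genus-1 maps at different crossings
      commute ([mulx_comm]).
    - At b itself the composites of the saddle with x_p + x_q vanish
      ([saddle_strands_eq0]), because p and q lie on one circle before or after
      the saddle, so x_p = x_q on one of its two sides.

    That p and q share a circle in one of the two smoothings of b
    ([circle_or_toggle]) is shown by counting ends of edges modulo 2.  To
    compose the maps degree by degree, it suffices that the genus-1 map
    preserves the bidegree ([genus1_sing_basis]). *)

Set Implicit Arguments.
Unset Strict Implicit.
Unset Printing Implicit Defensive.

Import Order.TTheory GRing.Theory Num.Theory.
Local Open Scope ring_scope.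

(** * Maps induced on homology *)

Section InducedMaps.
Variable K : fieldType.

Lemma hclass_eq0 (U V W : vectType K) (f : 'Hom(U, V)) (g : 'Hom(V, W))
  (z : cycles g) : hclass f z = 0 <-> exists u, f u = vsval z.
Proof.
have -> : (hclass f z = 0) <-> (z - 0 \in boundaries f g).
  rewrite -quotv_classE /hclass;
    suff -> : quotv_class (boundaries f g) 0 = 0 by [].
  have := quotv_classD (boundaries f g) 0 0.
  by rewrite addr0 => /eqP; rewrite -subr_eq0 opprD addrA subrr add0r oppr_eq0
    => /eqP.
rewrite subr0 -memv_preim lfunE /=; split.
  by case/memv_imgP=> u _ ->; exists u.
by case=> u <-; exact: memv_img (memvf u).
Qed.

Lemma hclassB (U V W : vectType K) (f : 'Hom(U, V)) (g : 'Hom(V, W))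
  (z z' : cycles g) : hclass f (z - z') = hclass f z - hclass f z'.
Proof.
by apply/eqP; rewrite eq_sym subr_eq /hclass -quotv_classD subrK.
Qed.

Lemma hclassP (U V W : vectType K) (f : 'Hom(U, V)) (g : 'Hom(V, W)) (a : K)
  (z z' : cycles g) : hclass f (a *: z + z') = a *: hclass f z + hclass f z'.
Proof. by rewrite /hclass quotv_classD quotv_classZ. Qed.

Lemma hclass_eq (U V W : vectType K) (f : 'Hom(U, V)) (g : 'Hom(V, W))
    (z z' : cycles g) :
  hclass f z = hclass f z' <-> exists u, vsval z = vsval z' + f u.
Proof.
split=> [e|[u e]].
  have /hclass_eq0[u fu] : hclass f (z - z') = 0 by rewrite hclassB e subrr.
  by exists u; rewrite fu /= addrC subrK.
apply/eqP; rewrite -subr_eq0 -hclassB; apply/eqP/hclass_eq0.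
by exists u; rewrite /= e addrC addKr.
Qed.

Section Induced.
Variables (U V W U' V' W' : vectType K).
Variables (f : 'Hom(U, V)) (g : 'Hom(V, W)).
Variables (f' : 'Hom(U', V')) (g' : 'Hom(V', W')) (phi : 'Hom(V, V')).
Hypothesis phi_cycle : forall v, g v = 0 -> g' (phi v) = 0.
Hypothesis phi_bound : forall u, exists u', f' u' = phi (f u).

Definition cycle_image (z : cycles g) : cycles g' :=
  vsproj (lker g') (phi (vsval z)).

Lemma cycle_imageE z : vsval (cycle_image z) = phi (vsval z).
Proof.
rewrite vsprojK // memv_ker phi_cycle //.
by apply/eqP; rewrite -memv_ker subvsP.
Qed.

Definition induced_fun (x : homology f g) : homology f' g' :=
  hclass f' (cycle_image (repr x)).

Lemma induced_funE z : induced_fun (hclass f z) = hclass f' (cycle_image z).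
Proof.
apply/hclass_eq; rewrite !cycle_imageE.
have /hclass_eq[u ->] : hclass f (repr (hclass f z)) = hclass f z.
  by rewrite {1}/hclass /quotv_class reprK.
have [u' e] := phi_bound u.
by exists u'; rewrite linearD /= e.
Qed.

Fact induced_fun_linear : linear induced_fun.
Proof.
move=> a x y; have [u ->] := quotv_class_surj x;
  have [v ->] := quotv_class_surj y.
rewrite -/(hclass f u) -/(hclass f v).
transitivity (induced_fun (hclass f (a *: u + v))); first by rewrite hclassP.
by rewrite !induced_funE -hclassP /cycle_image !linearP.
Qed.

Definition induced_map : {linear homology f g -> homology f' g'} :=
  HB.pack induced_fun (GRing.isLinear.Build K _ _ _ induced_fun
    induced_fun_linear).

Lemma induced_mapP : induced_by phi induced_map.
Proof.
by move=> z; exists (cycle_image z); split;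
  [exact: cycle_imageE | exact: induced_funE].
Qed.

End Induced.

(** Exactness of a pair of induced maps as a condition on cycles and
    boundaries, so that the exactness proofs below can stay inside the
    complexes. *)
Lemma exact_induced
    (U V W U1 V1 W1 U2 V2 W2 : vectType K)
    (f : 'Hom(U, V)) (g : 'Hom(V, W))
    (f1 : 'Hom(U1, V1)) (g1 : 'Hom(V1, W1))
    (f2 : 'Hom(U2, V2)) (g2 : 'Hom(V2, W2))
    (phi : 'Hom(V, V1)) (psi : 'Hom(V1, V2))
    (F : homology f g -> homology f1 g1)
    (G : homology f1 g1 -> homology f2 g2) :
  induced_by phi F -> induced_by psi G ->
  (forall v1, g1 v1 = 0 ->
     (exists u2, f2 u2 = psi v1) <->
     (exists2 v, g v = 0 & exists u1, v1 = phi v + f1 u1)) ->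
  exact_at F G.
Proof.
move=> FP GP H y; have [z ->] := quotv_class_surj y; rewrite -/(hclass f1 z).
have z0 : g1 (vsval z) = 0 by apply/eqP; rewrite -memv_ker subvsP.
have [z2 [z2E ->]] := GP z.
rewrite hclass_eq0 z2E H //; split.
  case=> v v0 [u1 e].
  have vK : v \in lker g by rewrite memv_ker v0.
  exists (hclass f (Subvs vK)); have [z1 [z1E ->]] := FP (Subvs vK).
  apply/hclass_eq; exists (- u1); rewrite z1E e /=.
  by rewrite linearN /= addrK.
case=> x; have [v ->] := quotv_class_surj x; rewrite -/(hclass f v).
have [z1 [z1E ->]] := FP v => /esym /hclass_eq[u1 e].
exists (vsval v); first by apply/eqP; rewrite -memv_ker subvsP.
by exists u1; rewrite e z1E.
Qed.

End InducedMaps.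

(** * Mapping cones over the field with two elements *)

Lemma F2_addxx (x : 'F_2) : x + x = 0.
Proof. by apply: val_inj; case: x => -[|[|]]. Qed.

Lemma addvv_F2 (V : lmodType 'F_2) (v : V) : v + v = 0.
Proof. by rewrite -[v]scale1r -scalerDl F2_addxx scale0r. Qed.

(** [C] is the direct sum of [P] and [M].  The second injection [split_sec]
    and the projection [split_ret] are not chain maps in a cone. *)
Record splitting (P M C : vectType 'F_2) := Splitting {
  split_in : 'Hom(P, C);
  split_ret : 'Hom(C, P);
  split_out : 'Hom(C, M);
  split_sec : 'Hom(M, C);
  split_ret_in : forall x, split_ret (split_in x) = x;
  split_out_in : forall x, split_out (split_in x) = 0;
  split_ret_sec : forall y, split_ret (split_sec y) = 0;
  split_out_sec : forall y, split_out (split_sec y) = y;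
  split_inj : forall v w, split_ret v = split_ret w ->
    split_out v = split_out w -> v = w
}.

(** The differential of the mapping cone of [phi] is
    (x, y) |-> (d x + phi y, d y),
    where the sign of d y is irrelevant modulo 2. *)
Definition cone_differential (P M C P' M' C' : vectType 'F_2)
    (S : splitting P M C) (S' : splitting P' M' C')
    (dP : 'Hom(P, P')) (dM : 'Hom(M, M')) (phi : 'Hom(M, P'))
    (dC : 'Hom(C, C')) : Prop :=
  forall w,
    split_ret S' (dC w) = dP (split_ret S w) + phi (split_out S w)
    /\ split_out S' (dC w) = dM (split_out S w).

Section MappingCone.
Variables (P0 P1 P2 M1 M2 M3 C0 C1 C2 : vectType 'F_2).
Variables (S0 : splitting P0 M1 C0) (S1 : splitting P1 M2 C1).
Variable S2 : splitting P2 M3 C2.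
Variables (dP0 : 'Hom(P0, P1)) (dP1 : 'Hom(P1, P2)).
Variables (dM1 : 'Hom(M1, M2)) (dM2 : 'Hom(M2, M3)).
Variables (dC0 : 'Hom(C0, C1)) (dC1 : 'Hom(C1, C2)).
Variables (phi1 : 'Hom(M1, P1)) (phi2 : 'Hom(M2, P2)).
Hypothesis phi_chain : forall y, phi2 (dM1 y) = dP1 (phi1 y).
Hypothesis cone0 : cone_differential S0 S1 dP0 dM1 phi1 dC0.
Hypothesis cone1 : cone_differential S1 S2 dP1 dM2 phi2 dC1.

Lemma split_in_cycle v : dP1 v = 0 -> dC1 (split_in S1 v) = 0.
Proof.
move=> v0; have [r o] := cone1 (split_in S1 v).
apply: (split_inj (s := S2)); rewrite ?r ?o split_out_in !linear0 //.
by rewrite split_ret_in v0 addr0.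
Qed.

Lemma split_in_boundary u : dC0 (split_in S0 u) = split_in S1 (dP0 u).
Proof.
have [r o] := cone0 (split_in S0 u).
apply: (split_inj (s := S1)); rewrite ?r ?o !split_out_in !linear0 //.
by rewrite !split_ret_in addr0.
Qed.

Lemma split_out_cycle v : dC1 v = 0 -> dM2 (split_out S1 v) = 0.
Proof. by move=> v0; rewrite -(cone1 v).2 v0 linear0. Qed.

(** The boundary of (u, y) is (d u + phi y, d y), so it has the form (v, 0)
    exactly when y is a cycle and v - d u = phi y. *)
Lemma cone_exact_pos v :
  (exists w, dC0 w = split_in S1 v) <->
  (exists2 y, dM1 y = 0 & exists u, v = phi1 y + dP0 u).
Proof.
split=> [[w wE]|[y y0 [u vE]]].
  have [r o] := cone0 w; exists (split_out S0 w).
    by rewrite -o wE split_out_in.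
  by exists (split_ret S0 w); rewrite addrC -r wE split_ret_in.
exists (split_in S0 u + split_sec S0 y).
have [r o] := cone0 (split_in S0 u + split_sec S0 y).
apply: (split_inj (s := S1)); rewrite ?r ?o !linearD /= !split_out_in.
  by rewrite !split_ret_in split_ret_sec split_out_sec !linear0 addr0 add0r
    addrC.
by rewrite split_out_sec y0 linear0 addr0.
Qed.

(** If d y is the second component of [v], then [v] minus the boundary of (0, y)
    lies in the first summand. *)
Lemma cone_exact_cone v : dC1 v = 0 ->
  (exists y, dM1 y = split_out S1 v) <->
  (exists2 x, dP1 x = 0 & exists w, v = split_in S1 x + dC0 w).
Proof.
move=> v0; split=> [[y yE]|[x x0 [w ->]]]; last first.
  exists (split_out S0 w).
  by rewrite -(cone0 w).2 linearD /= split_out_in add0r.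
have [r o] := cone0 (split_sec S0 y).
move: r o; set dw := dC0 _;
  rewrite split_ret_sec split_out_sec linear0 add0r => r o.
exists (split_ret S1 (v - dw)).
  have [+ _] := cone1 v; rewrite v0 linear0 => /esym /eqP.
  rewrite addr_eq0 => /eqP dv.
  rewrite !linearB /= dv r -phi_chain yE -opprD addvv_F2 oppr0 //.
exists (split_sec S0 y); apply: (split_inj (s := S1)); rewrite linearD /=.
  by rewrite split_ret_in linearB /= subrK.
by rewrite split_out_in add0r -/dw o yE.
Qed.

(** (x, y) is a cycle exactly when d y = 0 and d x = phi y. *)
Lemma cone_exact_neg y : dM2 y = 0 ->
  (exists x, dP1 x = phi2 y) <->
  (exists2 w, dC1 w = 0 & exists y', y = split_out S1 w + dM1 y').
Proof.
move=> y0; split=> [[x xE]|[w w0 [y' yE]]].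
  exists (split_in S1 x + split_sec S1 y).
    have [r o] := cone1 (split_in S1 x + split_sec S1 y).
    apply: (split_inj (s := S2)); rewrite ?r ?o !linearD /= split_out_in.
      rewrite split_ret_in split_ret_sec split_out_sec !linear0 addr0 add0r.
      by rewrite xE addvv_F2.
    by rewrite split_out_sec y0 !linear0 addr0.
  by exists 0; rewrite linear0 addr0 linearD /= split_out_in split_out_sec
    add0r.
exists (split_ret S1 w + phi1 y').
have [+ _] := cone1 w; rewrite w0 linear0 => /esym /eqP.
rewrite addr_eq0 => /eqP h.
rewrite linearD /= h -phi_chain yE linearD /=; congr (_ + _).
by apply/eqP; rewrite eq_sym -subr_eq0 opprK addvv_F2.
Qed.

End MappingCone.

(** * Circles of a smoothing *)

Section Circles.
Variable G : shadow.
Implicit Types (w : pred (vtx G)) (c v : vtx G) (e f : edge G).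

(** A smoothing is encoded by the set [w] of vertices where it respects the
    orientation.  The circles depend on the signs of the crossings and on the
    state only through [w], and the genus-1 map changes both without changing
    [w]. *)
Definition link w v : rel (edge G) :=
  [rel e f | if w v
             then [exists l, (e == in_edge v l) && (f == out_edge v l)]
             else (e == in_edge v true) && (f == in_edge v false)
               || (e == out_edge v true) && (f == out_edge v false)].

Definition linked w : rel (edge G) :=
  [rel e f | [exists v, link w v e f || link w v f e]].

Definition circle w : rel (edge G) := connect (linked w).

Definition toggle w c : pred (vtx G) := fun v => w v (+) (v == c).

Lemma toggleK w c : toggle (toggle w c) c = w.
Proof.
by apply: functional_extensionality => v; rewrite /toggle -addbA addbb addbF.
Qed.

Definition linked_off w c : rel (edge G) :=
  [rel e f | [exists (v | v != c), link w v e f || link w v f e]].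

Definition near w c e : bool :=
  circle w (in_edge c true) e || circle w (out_edge c false) e.

Lemma linked_sym w : symmetric (linked w).
Proof.
by move=> e f; apply/existsP/existsP => -[v]; rewrite orbC; exists v.
Qed.

Lemma linked_off_sym w c : symmetric (linked_off w c).
Proof.
by move=> e f; apply: eq_existsb => v; rewrite orbC.
Qed.

Lemma circle_refl w e : circle w e e.
Proof. exact: connect0. Qed.

Lemma circle_sym w e f : circle w e f = circle w f e.
Proof. exact: (sym_connect_sym (@linked_sym w)). Qed.

Lemma circle_trans w : transitive (circle w).
Proof. exact: connect_trans. Qed.

Lemma circle_left w e f g : circle w e f -> circle w e g = circle w f g.
Proof.
by move=> h; rewrite /circle (same_connect (sym_connect_sym (@linked_sym w)) h).
Qed.

Lemma circle_right w e f g : circle w e f -> circle w g e = circle w g f.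
Proof.
by move=> h; rewrite /circle (same_connect_r (sym_connect_sym (@linked_sym w))
  h).
Qed.

Lemma linked_off_toggle w c : linked_off (toggle w c) c =2 linked_off w c.
Proof.
move=> e f; apply: eq_existsb => v; case: (boolP (v == c)) => //= vc.
by rewrite /link /= /toggle (negPf vc) addbF.
Qed.

Lemma link_oriented w v l : w v -> link w v (in_edge v l) (out_edge v l).
Proof. by rewrite /link /= => ->; apply/existsP; exists l; rewrite !eqxx. Qed.

Lemma link_unoriented w v : ~~ w v ->
  link w v (in_edge v true) (in_edge v false)
  /\ link w v (out_edge v true) (out_edge v false).
Proof. by rewrite /link /= => /negPf->; rewrite !eqxx orbT. Qed.

Lemma link_circle w v e f : link w v e f -> circle w e f.
Proof. by move=> h; apply: connect1; apply/existsP; exists v; rewrite h. Qed.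

Lemma link_off w c v e f :
  v != c -> link w v e f -> connect (linked_off w c) e f.
Proof.
by move=> vc h; apply: connect1; apply/existsP; exists v; rewrite vc h.
Qed.

Lemma off_circle w c e f : connect (linked_off w c) e f -> circle w e f.
Proof.
apply: connect_sub => {}e {}f /existsP[v /andP[_ h]].
by apply: connect1; apply/existsP; exists v.
Qed.

Lemma off_circle_toggle w c e f :
  connect (linked_off w c) e f -> circle (toggle w c) e f.
Proof. by rewrite -(eq_connect (linked_off_toggle w c)); apply: off_circle. Qed.

(** A change of smoothing at [c] merges the two strands at [c] if they were on
    different circles.  If the strands were separated in both smoothings, then,
    with the links at [c] removed, the component [K] of the SW edge at [c] would
    contain none of the other three edges at [c].  But the number of ends of
    edges that belong to [K] is even, since every edge of [K] that meets a
    vertex has two ends, and at the vertices other than [c] these ends are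
    paired by the smoothing. *)
Lemma circle_or_toggle w c :
  circle w (in_edge c true) (out_edge c false)
  || circle (toggle w c) (in_edge c true) (out_edge c false).
Proof.
wlog wc : w / w c => [IH|].
  case: (boolP (w c)) => [/IH//|wc].
  by have := IH (toggle w c); rewrite toggleK orbC {1}/toggle eqxx addbT; apply.
apply/norP => -[] /negP nw /negP nt.
pose K e := connect (linked_off w c) (in_edge c true) e.
have tc : ~~ toggle w c c by rewrite /toggle eqxx wc.
have [_ lout] := link_unoriented tc.
have K_link v e f : v != c -> link w v e f -> K e = K f.
  move=> vc /(link_off vc) h; rewrite /K.
  by rewrite (same_connect_r (sym_connect_sym (@linked_off_sym w c)) h).
pose par v l := K (out_edge v l) (+) K (in_edge v l).
have even0 : \big[addb/false]_(x : vtx G * bool) par x.1 x.2 = false.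
  have e : \big[addb/false]_(x : vtx G * bool) K (out_edge x.1 x.2)
           = \big[addb/false]_(x : vtx G * bool) K (in_edge x.1 x.2).
    rewrite (reindex_inj (@perm_inj _ (Defs.arc G)^-1%g)).
    by apply: eq_bigr => x _; rewrite /out_edge /in_edge -!surjective_pairing.
  by rewrite big_split /= e addbb.
(* [par v l] is the parity of the two ends on side [l] of [v]; the vertices
   other than [c] contribute 0, and [c] contributes 1 by its SW end *)
have other v : v != c -> \big[addb/false]_l par v l = false.
  move=> vc; rewrite big_bool /par; case: (boolP (w v)) => wv.
    by rewrite -!(K_link v _ _ vc (link_oriented _ wv)) !addbb.
  have [h1 h2] := link_unoriented wv.
  by rewrite (K_link v _ _ vc h1) (K_link v _ _ vc h2) /= addbb.
move: even0; rewrite -(pair_bigA _ (fun v l => par v l)) /=.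
rewrite (bigD1 c) //= (eq_bigr _ other) big1_eq big_bool /par.
have -> : K (in_edge c true) by apply: connect0.
have -> : K (out_edge c false) = false.
  by apply/negP => /off_circle.
have -> : K (in_edge c false) = false.
  apply/negP => /off_circle h; apply: nw; apply: circle_trans h _.
  exact: link_circle (link_oriented _ wc).
have -> // : K (out_edge c true) = false.
apply/negP => /off_circle_toggle h; apply: nt; apply: circle_trans h _.
exact: link_circle lout.
Qed.

Definition corner c : {set edge G} :=
  [set in_edge c true; in_edge c false; out_edge c true; out_edge c false].

Lemma link_corner w c e f :
  link w c e f -> (e \in corner c) && (f \in corner c).
Proof.
rewrite /link /= !inE; case: (w c).
  by case/existsP=> -[] /andP[/eqP-> /eqP->]; rewrite !eqxx ?orbT.
by case/orP=> /andP[/eqP-> /eqP->]; rewrite !eqxx ?orbT.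
Qed.

Lemma corner_near w c e : e \in corner c -> near w c e.
Proof.
rewrite !inE -!orbA /near; case: (boolP (w c)) => wc.
  have h1 := link_circle (link_oriented true wc).
  have := link_circle (link_oriented false wc); rewrite circle_sym => h2.
  by case/or4P=> /eqP->; rewrite ?circle_refl ?h1 ?h2 ?orbT.
have [/link_circle h1 /link_circle] := link_unoriented wc;
  rewrite circle_sym => h2.
by case/or4P=> /eqP->; rewrite ?circle_refl ?h1 ?h2 ?orbT.
Qed.

Definition near_off w c e : bool :=
  [exists k in corner c, connect (linked_off w c) k e].

(** The circles that pass near [c] cover the same edges before and after a
    change of smoothing at [c], and the other circles do not change.  Both
    facts ([near_toggle], [circle_toggle]) follow because a path along a circle
    either avoids the links at [c] or joins two edges that are connected to
    edges at [c] without these links. *)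
Lemma circle_off w c e f :
  circle w e f -> connect (linked_off w c) e f || near_off w c e &&
    near_off w c f.
Proof.
case/connectP=> p; elim: p e => [|g p IH] e /=.
  by move=> _ ->; rewrite connect0.
case/andP=> eg /IH{}IH /IH{}IH.
have [v h] := existsP eg; case: (eqVneq v c) h => [->|vc] h.
  have /andP[ke kg] : (e \in corner c) && (g \in corner c).
    by case/orP: h => /link_corner //; rewrite andbC.
  apply/orP; right; apply/andP; split.
    by apply/existsP; exists e; rewrite ke connect0.
  case/orP: IH => [gf|/andP[]//].
  by apply/existsP; exists g; rewrite kg.
have eg' : connect (linked_off w c) e g.
  by apply: connect1; apply/existsP; exists v; rewrite vc.
case/orP: IH => [gf|/andP[/existsP[k /andP[kc kg]] ->]].
  by rewrite (connect_trans eg' gf).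
apply/orP; right; rewrite andbT; apply/existsP; exists k; rewrite kc /=.
apply: connect_trans kg _.
by rewrite (sym_connect_sym (@linked_off_sym w c)).
Qed.

Lemma near_offE w c e : near w c e = near_off w c e.
Proof.
have corner_off k : k \in corner c -> near_off w c k.
  by move=> kc; apply/existsP; exists k; rewrite kc connect0.
have sub k : k \in corner c -> circle w k e -> near_off w c e.
  move=> kc /(circle_off c) /orP[h|/andP[]//].
  by apply/existsP; exists k; rewrite kc.
apply/idP/idP => [/orP[]|/existsP[k /andP[kc /off_circle ke]]].
- by apply: sub; rewrite !inE eqxx.
- by apply: sub; rewrite !inE eqxx ?orbT.
by have /orP[/circle_trans/(_ ke)|/circle_trans/(_ ke)] := corner_near w kc;
  rewrite /near => ->; rewrite ?orbT.
Qed.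

Lemma near_toggle w c e : near (toggle w c) c e = near w c e.
Proof.
rewrite !near_offE; apply: eq_existsb => k.
by rewrite (eq_connect (linked_off_toggle w c)).
Qed.

Lemma circle_toggle w c e f :
  ~~ near w c e -> circle (toggle w c) e f = circle w e f.
Proof.
move=> ne; apply/idP/idP => /(circle_off c);
  rewrite -!near_offE ?near_toggle (negPf ne) orbF.
  by rewrite (eq_connect (linked_off_toggle w c)); apply: off_circle.
exact: off_circle_toggle.
Qed.

Lemma near_circle w c e f : circle w e f -> near w c e = near w c f.
Proof. by move=> ef; rewrite /near !(circle_right _ ef). Qed.

End Circles.

(** * Saddles and multiplication by x *)

Section Labellings.
Variable G : shadow.
Implicit Types (w : pred (vtx G)) (c v b : vtx G) (e f : edge G).
Implicit Types (l m k : labelling G).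

Definition constant_on_circles w l : bool :=
  [forall e, forall f, circle w e f ==> (l e == l f)].

Lemma constantP w l :
  reflect (forall e f, circle w e f -> l e = l f) (constant_on_circles w l).
Proof.
apply: (iffP forallP) => [h e f ef|h e].
  by move/forallP/(_ f)/implyP/(_ ef)/eqP: (h e).
by apply/forallP=> f; apply/implyP=> /h->.
Qed.

Definition agree w c l m : bool :=
  [forall e, [|| circle w (in_edge c true) e, circle w (out_edge c false) e
                | l e == m e]].

Lemma agreeP w c l m :
  reflect (forall e, ~~ near w c e -> l e = m e) (agree w c l m).
Proof.
apply: (iffP forallP) => [h e|h e].
  rewrite /near negb_or => /andP[/negPf n1 /negPf n2].
  by have := h e; rewrite n1 n2 => /eqP.
rewrite orbA -/(near w c e); case: (boolP (near w c e)) => //= n; apply/eqP;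
  exact: h n.
Qed.

Definition saddle w c l m : 'F_2 :=
  let p := in_edge c true in
  let q := out_edge c false in
  if ~~ agree w c l m then 0
  else if ~~ circle w p q then mu_coef (l p) (l q) (m p)
  else if ~~ circle (toggle w c) p q then delta_coef (l p) (m p) (m q)
  else 0.

Definition genus1 w b l m : 'F_2 :=
  let p := in_edge b true in
  let q := out_edge b false in
  if ~~ agree w b l m then 0
  else if ~~ circle w p q then
    \sum_a mu_coef (l p) (l q) a * delta_coef a (m p) (m q)
  else
    \sum_a \sum_a' delta_coef (l p) a a' * mu_coef a a' (m p).

(** [raise] and [lower] put the label x, respectively 1, on the circle of [e].
    Multiplication by x on that circle kills a labelling with x there and
    raises the others, and [lower] finds the preimage of a raised labelling. *)
Definition raise w e l : labelling G := [ffun f => l f || circle w e f].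
Definition lower w e m : labelling G := [ffun f => m f && ~~ circle w e f].

Definition mulx w e l m : 'F_2 := (~~ l e && (m == raise w e l))%:R.

Lemma raise_constant w e l :
  constant_on_circles w l -> constant_on_circles w (raise w e l).
Proof.
move/constantP=> h; apply/constantP => f g fg.
by rewrite !ffunE (h _ _ fg) (circle_right _ fg).
Qed.

Lemma lower_constant w e m :
  constant_on_circles w m -> constant_on_circles w (lower w e m).
Proof.
move/constantP=> h; apply/constantP => f g fg.
by rewrite !ffunE (h _ _ fg) (circle_right _ fg).
Qed.

Lemma raise_circle w e f l : circle w e f -> raise w e l = raise w f l.
Proof. by move=> ef; apply/ffunP=> g; rewrite !ffunE (circle_left _ ef). Qed.

Lemma mulx_circle w e f l m : constant_on_circles w l ->
  circle w e f -> mulx w e l m = mulx w f l m.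
Proof.
by move=> /constantP h ef; rewrite /mulx (raise_circle _ ef) (h _ _ ef).
Qed.

Lemma sum_mulx_l w e l (F : labelling G -> 'F_2) : constant_on_circles w l ->
  \sum_(k | constant_on_circles w k) mulx w e l k * F k
    = (~~ l e)%:R * F (raise w e l).
Proof.
move=> lw; rewrite (bigD1 (raise w e l)) ?raise_constant //=.
rewrite big1 => [|k /andP[_ /negPf nk]]; last by rewrite /mulx nk andbF mul0r.
by rewrite /mulx eqxx andbT addr0.
Qed.

Lemma sum_mulx_r w e m (F : labelling G -> 'F_2) : constant_on_circles w m ->
  \sum_(k | constant_on_circles w k) F k * mulx w e k m
    = (m e)%:R * F (lower w e m).
Proof.
move=> mw; rewrite (bigD1 (lower w e m)) ?lower_constant //=.
rewrite big1 => [|k /andP[kw nk]].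
  rewrite addr0 mulrC /mulx ffunE circle_refl andbF /=.
  congr (_%:R * _); congr nat_of_bool; apply/eqP/idP => [->|me].
    by rewrite !ffunE circle_refl orbT.
  apply/ffunP=> f; rewrite !ffunE; case: (boolP (circle w e f)) => [ef|].
    by rewrite orbT -(constantP _ _ mw _ _ ef).
  by rewrite andbT orbF.
rewrite /mulx; case: (boolP (~~ _ && _)) => [/andP[ke /eqP mE]|];
  last by rewrite mulr0.
case/eqP: nk; apply/ffunP=> f; rewrite mE !ffunE.
case: (boolP (circle w e f)) => [ef|]; last by rewrite andbT orbF.
by rewrite andbF -(constantP _ _ kw _ _ ef) (negPf ke).
Qed.

Definition mulx_strands w b l m : 'F_2 :=
  mulx w (in_edge b true) l m + mulx w (out_edge b false) l m.

(** On two circles, the map p (x) q |-> Delta (p q) is multiplication by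
    Delta 1 = x (x) 1 + 1 (x) x; on one circle, mu (Delta p) = 2 x p vanishes
    modulo 2, and so does x_p + x_q. *)
Lemma genus1E w b l m :
  constant_on_circles w l -> constant_on_circles w m ->
  genus1 w b l m = mulx_strands w b l m.
Proof.
move=> lw mw; rewrite /genus1 /mulx_strands; set p := in_edge b true;
  set q := out_edge b false.
case: (boolP (circle w p q)) => [pq|npq] /=.
  rewrite (mulx_circle _ lw pq) F2_addxx !big_bool /=.
  by case: (agree _ _ _ _) => //=; case: (l p); case: (m p); apply: val_inj.
(* a labelling equals [raise w f l] as soon as it does so on the circle of
   [f], on the circle of [f'] and away from [b] *)
have raiseP f f' : (forall g, near w b g = circle w f g || circle w f' g) ->
    ~~ circle w f f' ->
    (m == raise w f l) = [&& agree w b l m, m f & m f' == l f'].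
  move=> nE ff'; apply/eqP/and3P => [->|[/agreeP ag mf /eqP mf']].
    rewrite !ffunE circle_refl orbT (negPf ff') orbF; split=> //.
    apply/agreeP=> g; rewrite nE !ffunE negb_or => /andP[/negPf-> _].
    by rewrite orbF.
  apply/ffunP=> g; rewrite ffunE.
  case: (boolP (circle w f g)) => [fg|nfg].
    by rewrite orbT -(constantP _ _ mw _ _ fg).
  case: (boolP (circle w f' g)) => [fg|nfg'].
    by rewrite orbF -(constantP _ _ mw _ _ fg) -(constantP _ _ lw _ _ fg).
  by rewrite orbF ag // nE negb_or nfg.
rewrite /mulx (raiseP p q) // (raiseP q p) //; last first.
- by rewrite circle_sym.
- by move=> g; rewrite orbC.
rewrite !big_bool; case: (agree _ _ _ _) => /=; last by rewrite !andbF addr0.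
by case: (l p); case: (l q); case: (m p); case: (m q); apply: val_inj.
Qed.

Lemma saddle_disagree w c l m : ~~ agree w c l m -> saddle w c l m = 0.
Proof. by rewrite /saddle => ->. Qed.

(** A saddle commutes with multiplication by x at any edge [e]; this is the
    equality of single matrix entries behind [saddle_comm_mulx].  If the circle
    of [e] stays away from [c], then the saddle does not see it.  Otherwise
    this is the A-linearity of the product (where [circle_or_toggle] ensures
    that the saddle really merges) or of the coproduct. *)
Lemma saddle_mulx w c e l m :
  constant_on_circles w l -> constant_on_circles (toggle w c) m ->
  (~~ l e)%:R * saddle w c (raise w e l) m
    = (m e)%:R * saddle w c l (lower (toggle w c) e m).
Proof.
move=> lw mw; set w' := toggle w c.
set p := in_edge c true; set q := out_edge c false.
case: (boolP (near w c e)) => [ne|fe]; last first.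
  have cE f : circle w' e f = circle w e f by apply: circle_toggle.
  have [/negPf ep /negPf eq] : ~~ circle w e p /\ ~~ circle w e q.
    by apply/norP; rewrite ![circle w e _]circle_sym.
  case le: (l e).
    rewrite mul0r saddle_disagree ?mulr0 //; apply/negP=> /agreeP/(_ e fe).
    by rewrite le ffunE circle_refl andbF.
  case me: (m e); last first.
    rewrite mul0r saddle_disagree ?mulr0 //; apply/negP=> /agreeP/(_ e fe).
    by rewrite me ffunE circle_refl orbT.
  rewrite !mul1r /saddle -/p -/q !ffunE !cE ep eq !orbF !andbT.
  suff -> : agree w c (raise w e l) m = agree w c l (lower w' e m) by [].
  apply/agreeP/agreeP => h f nf; have := h f nf; rewrite !ffunE cE;
    case: (boolP (circle w e f)) => [ef|]; rewrite ?orbF ?andbT //.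
    by rewrite -(constantP _ _ lw _ _ ef) le andbF.
  by rewrite -(constantP _ _ mw e f) ?cE // me orbT.
have far_circle f : ~~ near w c f ->
  circle w e f = false /\ circle w' e f = false.
  move=> nf; split; apply/negP=> /(near_circle c);
    rewrite ?near_toggle ne => /esym h.
    by rewrite h in nf.
  by rewrite h in nf.
have ag1 : agree w c (raise w e l) m = agree w c l m.
  by apply/agreeP/agreeP => h f nf; have := h f nf;
    rewrite ffunE (far_circle f nf).1 orbF.
have ag2 : agree w c l (lower w' e m) = agree w c l m.
  by apply/agreeP/agreeP => h f nf; have := h f nf;
    rewrite ffunE (far_circle f nf).2 andbT.
rewrite /saddle ag1 ag2 -/p -/q -/w' !ffunE.
case: (agree w c l m); last by rewrite !mulr0.
case: (boolP (circle w p q)) => [pq|npq] /=.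
  case: (boolP (circle w' p q)) => [pq'|npq'] /=; first by rewrite !mulr0.
  have ep : circle w e p.
    by rewrite circle_sym; case/orP: ne => // qe; apply: circle_trans pq qe.
  rewrite ep orbT (constantP _ _ lw _ _ ep).
  have : near w' c e by rewrite near_toggle.
  rewrite /near -/p -/q ![circle w' _ e]circle_sym => /orP[ep'|eq'].
    rewrite ep' -(circle_left _ ep') in npq' *.
    rewrite (negPf npq') (constantP _ _ mw _ _ ep').
    by case: (l p); case: (m p); case: (m q); apply: val_inj.
  rewrite circle_sym -(circle_left _ eq') in npq'.
  rewrite eq' (negPf npq') (constantP _ _ mw _ _ eq').
  by case: (l p); case: (m p); case: (m q); apply: val_inj.
have pq' : circle w' p q by have := circle_or_toggle w c; rewrite (negPf npq).
have ep' : circle w' e p.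
  have : near w' c e by rewrite near_toggle.
  rewrite circle_sym => /orP[//|qe].
  exact: circle_trans pq' qe.
rewrite ep' (constantP _ _ mw _ _ ep').
move: ne; rewrite /near -/p -/q ![circle w _ e]circle_sym => /orP[ep|eq].
  rewrite -(circle_left _ ep) in npq.
  rewrite ep (negPf npq) (constantP _ _ lw _ _ ep).
  by case: (l p); case: (l q); case: (m p); apply: val_inj.
rewrite circle_sym -(circle_left _ eq) in npq.
rewrite eq (negPf npq) (constantP _ _ lw _ _ eq).
by case: (l p); case: (l q); case: (m p); apply: val_inj.
Qed.

Lemma saddle_comm_mulx w c e l m :
  constant_on_circles w l -> constant_on_circles (toggle w c) m ->
  \sum_(k | constant_on_circles (toggle w c) k)
     saddle w c l k * mulx (toggle w c) e k m
  = \sum_(k | constant_on_circles w k) mulx w e l k * saddle w c k m.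
Proof. by move=> lw mw; rewrite sum_mulx_r // sum_mulx_l // saddle_mulx. Qed.

Lemma saddle_comm_strands w c b l m :
  constant_on_circles w l -> constant_on_circles (toggle w c) m ->
  \sum_(k | constant_on_circles (toggle w c) k)
     saddle w c l k * mulx_strands (toggle w c) b k m
  = \sum_(k | constant_on_circles w k) mulx_strands w b l k * saddle w c k m.
Proof.
move=> lw mw; rewrite /mulx_strands.
under eq_bigr do rewrite mulrDr; under [RHS]eq_bigr do rewrite mulrDl.
by rewrite !big_split /=; congr (_ + _); apply: saddle_comm_mulx.
Qed.

(** The strands at [b] lie on a single circle on one side of the saddle.  On
    that side x_p + x_q = 2 x_p = 0, and by [saddle_comm_strands] the
    multiplication can be done on either side. *)
Lemma saddle_strands_eq0 w b l m :
  constant_on_circles w l -> constant_on_circles (toggle w b) m ->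
  \sum_(k | constant_on_circles (toggle w b) k)
     saddle w b l k * mulx_strands (toggle w b) b k m = 0.
Proof.
move=> lw mw; case/orP: (circle_or_toggle w b) => h.
  rewrite saddle_comm_strands // big1 // => k kw.
  by rewrite /mulx_strands (mulx_circle _ lw h) F2_addxx mul0r.
by rewrite big1 // => k kw;
  rewrite /mulx_strands (mulx_circle _ kw h) F2_addxx mulr0.
Qed.

Lemma mulx_comm w e f l m :
  constant_on_circles w l -> constant_on_circles w m ->
  \sum_(k | constant_on_circles w k) mulx w e l k * mulx w f k m
  = \sum_(k | constant_on_circles w k) mulx w f l k * mulx w e k m.
Proof.
move=> lw mw; rewrite !sum_mulx_l // /mulx !ffunE -!natrM !mulnb.
have -> : raise w f (raise w e l) = raise w e (raise w f l).
  by apply/ffunP=> g; rewrite !ffunE orbAC.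
by rewrite !negb_or [circle w f e]circle_sym; do 2!case: (l _) => //=;
  rewrite ?andbF.
Qed.

Lemma mulx_strands_comm w b c l m :
  constant_on_circles w l -> constant_on_circles w m ->
  \sum_(k | constant_on_circles w k) mulx_strands w b l k * mulx_strands w c k m
  = \sum_(k | constant_on_circles w k) mulx_strands w c l k
    * mulx_strands w b k m.
Proof.
move=> lw mw; rewrite /mulx_strands.
under eq_bigr do rewrite mulrDr !mulrDl;
  under [RHS]eq_bigr do rewrite mulrDr !mulrDl.
rewrite !big_split /= addrACA; congr (_ + _ + (_ + _)); exact: mulx_comm.
Qed.

End Labellings.

(** * The genus-1 map of an ordinary diagram *)

Section LabelDegree.
Variable G : shadow.
Implicit Types (w : pred (vtx G)) (e : edge G) (l : labelling G).

Definition ldeg w l : int :=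
  (n_comp (linked w) [pred e | ~~ l e])%:Z
    - (n_comp (linked w) [pred e | l e])%:Z.

(** The circle of [e], counted by its root, goes from label 1 to label x. *)
Lemma ldeg_raise w e l : constant_on_circles w l -> ~~ l e ->
  ldeg w (raise w e l) = ldeg w l - 2%:Z.
Proof.
move=> lw le; rewrite /ldeg /n_comp_mem.
pose r := fingraph.root (linked w) e.
have er : circle w e r by apply: connect_root.
have lr : l r = false by rewrite -(constantP _ _ lw _ _ er) (negPf le).
have rr : fingraph.roots (linked w) r by apply: fingraph.roots_root;
  exact: (sym_connect_sym (@linked_sym _ w)).
have rE f : fingraph.roots (linked w) f -> circle w e f = (f == r).
  move=> /eqP fr; rewrite -{2}fr /r eq_sym root_connect //.
  exact: (sym_connect_sym (@linked_sym _ w)).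
rewrite [X in _ - X%:Z = _](cardD1 r) [X in _ = X%:Z - _ - _](cardD1 r).
rewrite !inE rr lr ffunE er orbT /=.
set a := #|_|; set b := #|_|; set a' := #|_|; set b' := #|_|.
have -> : a = a'.
  apply: eq_card => f; rewrite !inE ffunE;
    case: (boolP (fingraph.roots _ f)) => [/rE->|]; last by rewrite ?andbF.
  by rewrite /= negb_or andbC.
have -> : b = b'.
  apply: eq_card => f; rewrite !inE ffunE;
    case: (boolP (fingraph.roots _ f)) => [rf|]; last by rewrite ?andbF.
  rewrite (rE _ rf); case: eqP => [->|] /=; rewrite ?lr ?orbF //.
lia.
Qed.
End LabelDegree.

Lemma sum_if_eq (T : finType) (a : T) (F : T -> 'F_2) :
  \sum_u (if u == a then F u else 0) = F a.
Proof. by rewrite -big_mkcond big_pred1_eq. Qed.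

Section OrdinaryMaps.
Variable G : shadow.
Implicit Types (pos w : pred (vtx G)) (b c : vtx G) (s t : {set vtx G}).
Implicit Types (l m k : labelling G) (x y z : gen G).

Definition orient pos s : pred (vtx G) := fun v => pos v (+) (v \in s).

Definition constant_gen pos x : bool :=
  constant_on_circles (orient pos x.1) x.2.

Lemma orient_add pos c s :
  c \notin s -> orient pos (c |: s) = toggle (orient pos s) c.
Proof.
move=> cs; apply: functional_extensionality => v.
rewrite /orient /toggle in_setU1 -addbA; congr (_ (+) _).
by case: eqP => [->|] /=; rewrite ?(negPf cs) ?addbF.
Qed.

(** The genus-1 map at [b] goes from a state to a state of another diagram with
    the same smoothing. *)
Lemma orient_move pos b s :
  b \in s -> orient (toggle pos b) (s :\ b) = orient pos s.
Proof.
move=> bs; apply: functional_extensionality => v.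
rewrite /orient /toggle in_setD1 -addbA; congr (_ (+) _).
by case: eqP => [->|] /=; rewrite ?bs.
Qed.

Lemma orient_toggle pos b s : orient (toggle pos b) s = toggle (orient pos s) b.
Proof.
by apply: functional_extensionality => v; rewrite /orient /toggle addbAC.
Qed.

Lemma toggleC w b c : toggle (toggle w b) c = toggle (toggle w c) b.
Proof. by apply: functional_extensionality => v; rewrite /toggle addbAC. Qed.

Lemma diff_coefE pos s l t m :
  diff_coef (D := @Diagram G pos) (s, l) (t, m)
  = \sum_c (if (c \notin s) && (t == c |: s)
    then saddle (orient pos s) c l m else 0).
Proof.
rewrite /diff_coef big_mkcond; apply: eq_bigr => c _.
case: (boolP (c \notin s)) => //= cs; case: eqP => // _.
by rewrite /saddle -(orient_add pos cs).
Qed.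

Lemma genus1_coefE pos b s l t m :
  constant_gen pos (s, l) -> constant_gen (toggle pos b) (t, m) ->
  genus1_coef (D := @Diagram G pos) b (s, l) (t, m)
  = ((b \in s) && (t == s :\ b))%:R * mulx_strands (orient pos s) b l m.
Proof.
rewrite /constant_gen /= => lw mw.
transitivity (if (b \in s) && (t == s :\ b)
  then genus1 (orient pos s) b l m else 0).
  rewrite /genus1_coef /genus1.
  case: (b \in s) => //=; case: (t == s :\ b) => //=.
case: (boolP (b \in s)) => bs /=; last by rewrite mul0r.
case: eqP => [tE|_]; last by rewrite mul0r.
by move: mw; rewrite tE orient_move // mul1r => mw; rewrite genus1E.
Qed.

Lemma sum_gen pos (F : gen G -> 'F_2) :
  \sum_(y | constant_gen pos y) F y
  = \sum_u \sum_(k | constant_on_circles (orient pos u) k) F (u, k).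
Proof.
rewrite (pair_big_dep xpredT (fun u k => constant_on_circles (orient pos u) k)).
by apply: eq_big => [[u k]|[u k] _].
Qed.

(** Both composites are sums over the crossings [c] of the saddle at [c].  For
    [c != b] the terms agree because saddles commute with multiplications by x,
    and for [c = b] both vanish by [saddle_strands_eq0]. *)
Lemma genus1_comm_diff pos b x z :
  constant_gen pos x -> constant_gen (toggle pos b) z ->
  \sum_(y | constant_gen pos y)
    diff_coef (D := @Diagram G pos) x y
      * genus1_coef (D := @Diagram G pos) b y z
  = \sum_(y | constant_gen (toggle pos b) y)
    genus1_coef (D := @Diagram G pos) b x y
      * diff_coef (D := @Diagram G (toggle pos b)) y z.
Proof.
case: x => s l; case: z => t m xw zw; rewrite !sum_gen.
set w := orient pos s.
have lw : constant_on_circles w l by [].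
pose A c := \sum_(k | constant_on_circles (toggle w c) k)
   saddle w c l k * mulx_strands (toggle w c) b k m.
transitivity (\sum_c (if [&& c \notin s, b \in c |: s & t == (c |: s) :\ b]
                      then A c else 0)).
  transitivity (\sum_u \sum_c
      if [&& u == c |: s, c \notin s, b \in c |: s & t == (c |: s) :\ b]
        then A c else 0).
    apply: eq_bigr => u _.
    transitivity (\sum_(k | constant_on_circles (orient pos u) k) \sum_c
       if [&& u == c |: s, c \notin s, b \in c |: s & t == (c |: s) :\ b]
       then saddle w c l k * mulx_strands (toggle w c) b k m else 0).
      apply: eq_bigr => k kw; rewrite diff_coefE genus1_coefE // mulr_suml.
      apply: eq_bigr => c _; case: (boolP (c \notin s)) => cs;
        rewrite ?andbF ?mul0r //=.
      case: eqP => [->|_]; rewrite ?mul0r //= orient_add //.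
      by case: (_ && _); rewrite ?mul1r ?mul0r ?mulr0.
    rewrite exchange_big; apply: eq_bigr => c _ /=.
    case: ifP => [/and3P[/eqP-> cs _]|_]; last by rewrite big1.
    by rewrite orient_add.
  rewrite exchange_big; apply: eq_bigr => c _ /=.
  by rewrite (bigD1 (c |: s)) //= eqxx /= big1 ?addr0 // => u /negPf->.
transitivity (\sum_c (if [&& b \in s, c \notin s :\ b & t == c |: (s :\ b)]
                      then A c else 0)).
  have A0 : t = s -> A b = 0.
    move=> ts; apply: saddle_strands_eq0 => //.
    by move: zw; rewrite /constant_gen /= ts orient_toggle.
  apply: eq_bigr => c _; case: (eqVneq c b) => [->|cb]; last first.
    have -> : [&& c \notin s, b \in c |: s & t == (c |: s) :\ b]
            = [&& b \in s, c \notin s :\ b & t == c |: s :\ b].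
      rewrite !inE cb eq_sym (negPf cb) /= andbCA; congr [&& _, _ & t == _].
      apply/setP=> v; rewrite !inE; case: (eqVneq v c) => [->|//].
      by rewrite cb.
    by [].
  rewrite setU11 setD11 /=; case: ifP => [/andP[bs /eqP ts]|_].
    by rewrite A0 ?if_same // ts setU1K.
  by case: ifP => // /andP[bs /eqP ts]; rewrite A0 // ts setD1K.
transitivity (\sum_u (if (b \in s) && (u == s :\ b) then
   \sum_c (if (c \notin u) && (t == c |: u) then A c else 0) else 0)).
  case: (boolP (b \in s)) => bs /=; last by rewrite !big1.
  by rewrite sum_if_eq.
apply: eq_bigr => u _.
case: ifP => [|nu]; last first.
  by rewrite big1 // => k kw; rewrite genus1_coefE // nu mul0r mul0r.
case/andP=> bs /eqP uE.
have wE : orient (toggle pos b) u = w by rewrite uE orient_move.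
transitivity (\sum_(k | constant_on_circles (orient (toggle pos b) u) k) \sum_c
   if (c \notin u) && (t == c |: u)
     then mulx_strands w b l k * saddle w c k m else 0).
  rewrite exchange_big; apply: eq_bigr => c _ /=.
  case: ifP => [/andP[cu /eqP tE]|_]; last by rewrite big1.
  rewrite wE /A saddle_comm_strands //.
  by move: zw; rewrite /constant_gen /= tE orient_add // wE.
apply: eq_bigr => k kw; rewrite genus1_coefE // diff_coefE bs uE eqxx mul1r
  mulr_sumr.
apply: eq_bigr => c _; rewrite -uE wE; case: ifP; by rewrite ?mulr0.
Qed.

(** Neither map changes the smoothing, so both composites are products of
    multiplications by x on the circles of one smoothing. *)
Lemma genus1_comm_genus1 pos b c x z : b != c ->
  constant_gen pos x -> constant_gen (toggle (toggle pos b) c) z ->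
  \sum_(y | constant_gen (toggle pos b) y)
    genus1_coef (D := @Diagram G pos) b x y
      * genus1_coef (D := @Diagram G (toggle pos b)) c y z
  = \sum_(y | constant_gen (toggle pos c) y)
    genus1_coef (D := @Diagram G pos) c x y
      * genus1_coef (D := @Diagram G (toggle pos c)) b y z.
Proof.
case: x => s l; case: z => t m.
suff H b' c' : b' != c' ->
  constant_gen pos (s, l) -> constant_gen (toggle (toggle pos b') c') (t, m) ->
  \sum_(y | constant_gen (toggle pos b') y)
    genus1_coef (D := @Diagram G pos) b' (s, l) y
      * genus1_coef (D := @Diagram G (toggle pos b')) c' y (t, m)
  = (if [&& b' \in s, c' \in s & t == s :\: [set b'; c']] then
     \sum_(k | constant_on_circles (orient pos s) k)
        mulx_strands (orient pos s) b' l k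
          * mulx_strands (orient pos s) c' k m else 0).
  move=> bc xw zw; rewrite !H //.
  - rewrite setUC andbCA; case: ifP => // /and3P[cs bs /eqP tE].
    apply: mulx_strands_comm => //; move: zw; rewrite /constant_gen /=.
    rewrite (_ : t = (s :\ b) :\ c) ?orient_move //.
      by rewrite !inE eq_sym bc.
    by rewrite tE setDDl setUC.
  - by rewrite eq_sym.
  - by rewrite toggleC.
move=> bc xw zw; rewrite sum_gen.
transitivity (\sum_u (if u == s :\ b' then
    if [&& b' \in s, c' \in s & t == s :\: [set b'; c']] then
     \sum_(k | constant_on_circles (orient pos s) k)
        mulx_strands (orient pos s) b' l k
          * mulx_strands (orient pos s) c' k m else 0 else 0)).
  apply: eq_bigr => u _; case: eqP => [uE|/eqP/negPf nu]; last first.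
    by rewrite big1 // => k kw; rewrite genus1_coefE // nu andbF !mul0r.
  case: (boolP (b' \in s)) => bs; last first.
    by rewrite big1 // => k kw; rewrite genus1_coefE // (negPf bs) !mul0r.
  have wE : orient (toggle pos b') u = orient pos s by rewrite uE orient_move.
  transitivity (\sum_(k | constant_on_circles (orient (toggle pos b') u) k)
     if (c' \in s) && (t == s :\: [set b'; c']) then
      mulx_strands (orient pos s) b' l k
        * mulx_strands (orient pos s) c' k m else 0).
    apply: eq_bigr => k kw; rewrite !genus1_coefE // bs uE eqxx mul1r -uE wE uE.
    rewrite in_setD1 eq_sym bc setDDl /=.
    by case: ifP; rewrite ?mul1r // mul0r mulr0.
  rewrite wE andTb; case: (boolP (_ && _)) => // _; by rewrite big1.
by rewrite sum_if_eq.
Qed.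

Lemma label_degreeE pos s l :
  label_degree (D := @Diagram G pos) s l = ldeg (orient pos s) l.
Proof. by []. Qed.

Lemma mulx_strands_ldeg w b l m : constant_on_circles w l ->
  mulx_strands w b l m != 0 -> ldeg w m = ldeg w l - 2%:Z.
Proof.
move=> lw; rewrite /mulx_strands /mulx.
case: (boolP (_ && _)) => [/andP[le /eqP->] _|_]; first exact: ldeg_raise.
rewrite add0r.
by case: (boolP (_ && _)) => [/andP[le /eqP->] _|//]; first exact: ldeg_raise.
Qed.

Lemma npos_toggle pos b : ~~ pos b ->
  npos (@Diagram G (toggle pos b)) = (npos (@Diagram G pos)).+1.
Proof.
move=> nb; rewrite /npos (cardsD1 b) inE /= /toggle eqxx addbT nb add1n;
  congr _.+1.
apply: eq_card => v; rewrite !inE /=.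
by case: eqP => [->|_]; rewrite ?(negPf nb) ?addbF.
Qed.

Lemma nneg_toggle pos b : ~~ pos b ->
  nneg (@Diagram G pos) = (nneg (@Diagram G (toggle pos b))).+1.
Proof.
move=> nb; rewrite /nneg (cardsD1 b) inE /= nb add1n; congr _.+1.
apply: eq_card => v; rewrite !inE /= /toggle.
by case: eqP => [->|_]; rewrite ?addbT ?addbF //= nb.
Qed.

(** The state loses [b] and the label degree drops by 2, which is exactly the
    change of the shifts when a negative crossing becomes positive. *)
Lemma genus1_basis pos b i j x y : ~~ pos b ->
  constant_gen pos x -> constant_gen (toggle pos b) y ->
  genus1_coef (D := @Diagram G pos) b x y != 0 ->
  basis (D := @Diagram G pos) i j x = basis (D := @Diagram G (toggle pos b)) i
    j y.
Proof.
case: x => s l; case: y => t m nb xw yw; rewrite genus1_coefE //.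
case: (boolP (_ && _)) => [/andP[bs /eqP tE]|_]; last by rewrite mul0r eqxx.
rewrite mul1r => /(mulx_strands_ldeg xw) dE.
rewrite /basis /ubasis npos_toggle // [nneg (@Diagram G pos)](nneg_toggle nb)
  !label_degreeE.
have -> : circle_labelling (D := @Diagram G pos) s l by exact: xw.
have -> : circle_labelling (D := @Diagram G (toggle pos b)) t m by exact: yw.
rewrite tE orient_move // dE /= (cardsD1 b s) bs.
move: (ldeg _ _) #|_| (nneg _) (npos _) => d n n1 n2.
by congr (_ && _); apply/eqP/eqP; lia.
Qed.

End OrdinaryMaps.

(** * The genus-1 map of a singular diagram *)

Lemma sum_only1 (T : finType) (a : T) (F : T -> 'F_2) :
  (forall c, c != a -> F c = 0) -> \sum_c F c = F a.
Proof. by move=> h; rewrite (bigD1 a) //= big1 ?addr0. Qed.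

Section Coordinates.
Variable T : finType.

Section One.
Variable B : pred T.
Implicit Types u v : {ffun {g | B g} -> ('F_2)^o}.

(** Coordinates are extended by 0 to all of [T], because the bases of D, D_+
    and D_- are different subsets of one type of generators. *)
Definition coord u (g : T) : 'F_2 := if insub g is Some g' then u g' else 0.

Lemma coord_val u (g : {g | B g}) : coord u (val g) = u g.
Proof. by rewrite /coord valK. Qed.

Lemma coord_out u g : ~~ B g -> coord u g = 0.
Proof. by move=> h; rewrite /coord insubN. Qed.

Lemma coord_inj u v : (forall g, B g -> coord u g = coord v g) -> u = v.
Proof. by move=> h; apply/ffunP=> g; rewrite -!coord_val h //; apply: valP. Qed.

Lemma coord_linear a u v g : coord (a *: u + v) g = a * coord u g + coord v g.
Proof.
rewrite /coord; case: insubP => [g' _ _|_]; first by rewrite !ffunE.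
by rewrite mulr0 addr0.
Qed.

Lemma coordD u v g : coord (u + v) g = coord u g + coord v g.
Proof. by rewrite -[u]scale1r coord_linear scale1r mul1r. Qed.

Lemma coord0 g : coord 0 g = 0.
Proof. by rewrite /coord; case: insub => // g'; rewrite ffunE. Qed.

Lemma coord_ffun (F : T -> 'F_2) g :
  coord [ffun h : {g | B g} => F (val h) : ('F_2)^o] g = if B g then F g else 0.
Proof.
rewrite /coord; case: insubP => [g' Bg gE|/negPf->//].
by rewrite ffunE gE Bg.
Qed.

Lemma sum_coord u (F : T -> 'F_2) :
  \sum_(g : {g | B g}) u g * F (val g) = \sum_g coord u g * F g.
Proof.
rewrite [RHS](bigID B) /= [X in _ + X]big1 ?addr0; last first.
  by move=> g h; rewrite coord_out ?mul0r.
rewrite [RHS](reindex_omap (val : {g | B g} -> T) insub) /=; last first.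
  by move=> g Bg; rewrite insubT.
apply: eq_big => [g|g _]; last by rewrite coord_val.
by rewrite valK eqxx (valP g).
Qed.
End One.

Section Two.
Variables B B' : pred T.

Lemma coord_coef_map (M : T -> T -> 'F_2) (u : {ffun {g | B g} -> ('F_2)^o}) h :
  coord (Defs.coef_map (fun (g : {g | B g}) (h : {h | B' h}) => M (val g) (val
    h)) u) h
  = if B' h then \sum_g coord u g * M g h else 0.
Proof.
case: ifP => Bh; last by rewrite coord_out ?Bh.
rewrite /coord insubT coef_mapE /= -(sum_coord u (fun g => M g h)).
by apply: eq_bigr => g _.
Qed.

Variables (c : pred T) (phi : T -> T).
Definition pull_fun (u : {ffun {g | B g} -> ('F_2)^o}) :
  {ffun {h | B' h} -> ('F_2)^o} :=
  [ffun h => if c (val h) then coord u (phi (val h)) else 0].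
Fact pull_fun_linear : linear pull_fun.
Proof.
move=> a u v; apply/ffunP=> h; rewrite !ffunE coord_linear.
by case: ifP => // _; rewrite scaler0 addr0.
Qed.
HB.instance Definition _ := GRing.isLinear.Build 'F_2
  {ffun {g | B g} -> ('F_2)^o} {ffun {h | B' h} ->
    ('F_2)^o} _ pull_fun pull_fun_linear.
Definition pull :
  'Hom({ffun {g | B g} -> ('F_2)^o}, {ffun {h | B' h} -> ('F_2)^o})
  := linfun pull_fun.
Lemma coord_pull u h :
  coord (pull u) h = if B' h && c h then coord u (phi h) else 0.
Proof.
rewrite lfunE /= /pull_fun (coord_ffun _ (fun h => if c h
  then coord u (phi h) else 0)).
by case: (B' h); case: (c h).
Qed.
End Two.
End Coordinates.

Section Singular.
Implicit Types (D : sing_diagram) (i j : int).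

Definition resolved_sign D (P : {set vtx D}) : pred (vtx D) := fun v =>
  match kind v with Positive => true | Negative => false | Double => v \in P
    end.

(** Generators of all bidegrees at once.  The commutation of the genus-1 map
    with the differential is proved over these; the restriction to one bidegree
    is then a matter of [genus1_sing_basis]. *)
Definition sing_constant D (g : sing_gen D) : bool :=
  (g.1 \subset double_points D) && constant_gen (resolved_sign g.1) g.2.

Lemma sing_basis_constant D i j (g : sing_gen D) :
  sing_basis i j g -> sing_constant g.
Proof.
case: g => P [s l] /andP[h /and3P[_ h' _]]; rewrite /sing_constant h.
exact: h'.
Qed.

Lemma sing_diff_coefE D (g h : sing_gen D) :
  sing_diff_coef g h
  = (h.1 == g.1)%:R * diff_coef (D := @Diagram D (resolved_sign g.1)) g.2 h.2
    + \sum_(b in double_points D :\: g.1 | h.1 == b |: g.1)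
        genus1_coef (D := @Diagram D (resolved_sign g.1)) b g.2 h.2.
Proof. by case: g; case: h. Qed.

Lemma resolved_sign_add D v (P : {set vtx D}) :
  v \in double_points D -> v \notin P ->
  resolved_sign (v |: P) = toggle (resolved_sign P) v.
Proof.
rewrite inE => dv vP; apply: functional_extensionality => u.
rewrite /resolved_sign /toggle in_setU1; case: (eqVneq u v) => [->|_];
  last by rewrite addbF.
by case: (kind v) dv => //= _; rewrite (negPf vP).
Qed.

Lemma coord_differential D i i' j (u : chain D i j) (h : sing_gen D) :
  coord (differential D j i i' u) h
  = if sing_basis i' j h
    then \sum_(g : sing_gen D) coord u g * sing_diff_coef g h else 0.
Proof. exact: coord_coef_map. Qed.

Lemma coord_genus1_map D (b : vtx D) i j
    (u : chain (resolve b Negative) i j) (h : sing_gen (resolve b Positive)) :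
  coord (genus1_map b i j u) h
  = if sing_basis i j h
    then \sum_(g : sing_gen (resolve b Negative)) coord u g
      * sing_genus1_coef g h
    else 0.
Proof.
exact: (@coord_coef_map (sing_gen D) (@sing_basis (resolve b Negative) i j)
  (@sing_basis (resolve b Positive) i j) (@sing_genus1_coef D b)).
Qed.

Section Cone.
Variables (D : sing_diagram) (b : vtx D).
Hypothesis hb : kind b = Double.
Variable j : int.
Let Dm := resolve b Negative.
Let Dp := resolve b Positive.
Implicit Types (P Q R : {set vtx D}) (x y z : gen D) (g h : sing_gen D).

Lemma double_points_resolve k : k <> Double ->
  double_points (resolve b k) = double_points D :\ b.
Proof.
by case: k => [||/(_ erefl)//] _; apply/setP=> v; rewrite !inE /=;
  case: (v == b).
Qed.

Lemma double_points_neg : double_points Dm = double_points D :\ b.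
Proof. exact: double_points_resolve. Qed.

Lemma double_points_pos : double_points Dp = double_points D :\ b.
Proof. exact: double_points_resolve. Qed.

Lemma b_double : b \in double_points D.
Proof. by rewrite inE hb. Qed.

Lemma resolved_sign_neg P :
  b \notin P -> resolved_sign (D := Dm) P = resolved_sign P.
Proof.
move=> nb; apply: functional_extensionality => v; rewrite /resolved_sign /=.
by case: eqP => // ->; rewrite hb (negPf nb).
Qed.

Lemma resolved_sign_pos P : resolved_sign (D := Dp) P = resolved_sign (b |: P).
Proof.
apply: functional_extensionality => v; rewrite /resolved_sign /= in_setU1.
by case: eqP => // ->; rewrite hb.
Qed.

Lemma resolved_sign_pos_neg P :
  resolved_sign (D := Dp) P = toggle (resolved_sign (D := Dm) P) b.
Proof.
apply: functional_extensionality => v; rewrite /resolved_sign /toggle /=.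
by case: eqP => // _; rewrite addbF.
Qed.

Lemma sing_genus1_coefE g h :
  sing_genus1_coef (b := b) g h
  = (h.1 == g.1)%:R * genus1_coef (D := @Diagram D (resolved_sign (D := Dm)
    g.1)) b g.2 h.2.
Proof. by case: g; case: h. Qed.

Lemma genus1_sing_basis i g h :
  sing_constant (D := Dm) g -> sing_constant (D := Dp) h ->
  sing_genus1_coef (b := b) g h != 0 ->
  sing_basis (D := Dm) i j g = sing_basis (D := Dp) i j h.
Proof.
rewrite sing_genus1_coefE.
case: g => P x; case: h => Q y /andP[/= Pd xw] /andP[/= Qd yw].
case: (Q =P P) => [QP|_]; last by rewrite mul0r eqxx.
rewrite mul1r => nz; rewrite /sing_basis Pd Qd /= QP double_points_neg
  double_points_pos.
rewrite QP resolved_sign_pos_neg in yw.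
have nb : ~~ resolved_sign (D := Dm) P b by rewrite /resolved_sign /= eqxx.
by rewrite (genus1_basis _ _ nb xw yw nz) -resolved_sign_pos_neg.
Qed.

Lemma sum_sing_gen E (F : sing_gen E -> 'F_2) :
  \sum_(g | sing_constant g) F g
  = \sum_(P : {set vtx E}) \sum_(x : gen E | (P \subset double_points E) &&
    constant_gen (resolved_sign P) x) F (P, x).
Proof.
rewrite (pair_big_dep xpredT (fun (P : {set vtx E}) (x : gen E) => (P \subset
  double_points E) && constant_gen (resolved_sign P) x)).
by apply: eq_big => [[P x]|[P x] _].
Qed.

(** The internal part of the differential is treated by [genus1_comm_diff], and
    the genus-1 maps at the other double points by [genus1_comm_genus1]. *)
Lemma sing_genus1_comm g h :
  sing_constant (D := Dm) g -> sing_constant (D := Dp) h ->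
  \sum_(k : sing_gen Dm | sing_constant k)
    sing_diff_coef (D := Dm) g k * sing_genus1_coef (b := b) k h
  = \sum_(k : sing_gen Dp | sing_constant k)
    sing_genus1_coef (b := b) g k * sing_diff_coef (D := Dp) k h.
Proof.
case: g => P x; case: h => Q z /andP[/= Pd xw] /andP[/= Qd zw].
rewrite (@sum_sing_gen Dm) (@sum_sing_gen Dp).
transitivity (\sum_(y | constant_gen (resolved_sign (D := Dm) Q) y)
  sing_diff_coef (D := Dm) (P, x) (Q, y)
   * genus1_coef (D := @Diagram D (resolved_sign (D := Dm) Q)) b y z).
  rewrite (@sum_only1 _ Q).
    apply: eq_big => [y|y _]; first by rewrite double_points_neg
      -double_points_pos Qd.
    by rewrite sing_genus1_coefE /= eqxx mul1r.
  move=> R; rewrite eq_sym => /negPf nR; rewrite big1 // => y _.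
  by rewrite sing_genus1_coefE /= nR mul0r mulr0.
transitivity (\sum_(y | constant_gen (resolved_sign (D := Dp) P) y)
  genus1_coef (D := @Diagram D (resolved_sign (D := Dm) P)) b x y
   * sing_diff_coef (D := Dp) (P, y) (Q, z)); last first.
  rewrite [RHS](@sum_only1 _ P).
    apply: eq_big => [y|y _]; first by rewrite double_points_pos
      -double_points_neg Pd.
    by rewrite eqxx mul1r.
  move=> R /negPf nR; rewrite big1 // => y _.
  by rewrite nR !mul0r.
under eq_bigr do rewrite sing_diff_coefE /= mulrDl.
under [RHS]eq_bigr do rewrite sing_diff_coefE /= mulrDr.
rewrite !big_split /=; congr (_ + _).
  case: eqP => [QP|_]; last first.
    by rewrite !big1 // => y _; rewrite ?mul0r ?mulr0.
  under eq_bigr do rewrite mul1r; under [RHS]eq_bigr do rewrite mul1r.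
  rewrite QP !resolved_sign_pos_neg in zw *.
  exact: genus1_comm_diff.
under eq_bigr do rewrite mulr_suml; under [RHS]eq_bigr do rewrite mulr_sumr.
rewrite exchange_big [RHS]exchange_big /= double_points_neg double_points_pos.
apply: eq_bigr => v /andP[]; rewrite !inE => /and3P[vP vb vd] /eqP QE.
have vdm : v \in double_points Dm by rewrite double_points_neg !inE vb vd.
have e := resolved_sign_add vdm vP; rewrite QE in zw *.
rewrite !resolved_sign_pos_neg e in zw *.
by apply: genus1_comm_genus1.
Qed.

(** In each composite, the intermediate generators are linked by a nonzero
    coefficient of the genus-1 map either to the source or to the target, so by
    [genus1_sing_basis] the sum over one bidegree is the sum over all
    generators. *)
Lemma genus1_map_chain i i' (u : chain Dm i j) :
  genus1_map b i' j (differential Dm j i i' u)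
  = differential Dp j i i' (genus1_map b i j u).
Proof.
apply: coord_inj => h hB; rewrite coord_genus1_map coord_differential hB.
under eq_bigr => k _ do rewrite coord_differential.
under [RHS]eq_bigr => k _ do rewrite coord_genus1_map.
have hc := sing_basis_constant hB.
transitivity (\sum_g coord u g * \sum_(k : sing_gen Dm | sing_constant k)
    sing_diff_coef (D := Dm) g k * sing_genus1_coef (b := b) k h).
  under [RHS]eq_bigr do rewrite mulr_sumr.
  rewrite [RHS]exchange_big [RHS]big_mkcond /=; apply: eq_bigr => k _.
  case: (boolP (sing_constant (D := Dm) k)) => kc; last first.
    case: ifP => [/sing_basis_constant h'|_]; last by rewrite mul0r.
    by rewrite h' in kc.
  case: (eqVneq (sing_genus1_coef (b := b) k h) 0) => [->|nz].
    by rewrite mulr0 big1 // => g _; rewrite !mulr0.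
  rewrite (genus1_sing_basis i' kc hc nz) hB mulr_suml.
  by apply: eq_bigr => g _; rewrite mulrA.
transitivity (\sum_g coord u g * \sum_(k : sing_gen Dp | sing_constant k)
    sing_genus1_coef (b := b) g k * sing_diff_coef (D := Dp) k h).
  apply: eq_bigr => g _.
  case: (boolP (sing_basis (D := Dm) i j g)) => gB;
    last by rewrite coord_out ?mul0r.
  by rewrite sing_genus1_comm //; apply: sing_basis_constant gB.
transitivity (\sum_g \sum_k (if sing_basis (D := Dp) i j k then
   coord u g * sing_genus1_coef (b := b) g k
     * sing_diff_coef (D := Dp) k h else 0)).
  apply: eq_bigr => g _.
  case: (boolP (sing_basis (D := Dm) i j g)) => gB; last first.
    by rewrite coord_out // mul0r big1 // => k _; rewrite !mul0r if_same.
  have gc := sing_basis_constant gB.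
  rewrite mulr_sumr big_mkcond /=; apply: eq_bigr => k _.
  case: (boolP (sing_constant (D := Dp) k)) => kc; last first.
    case: ifP => // /sing_basis_constant h'.
    by rewrite h' in kc.
  case: (eqVneq (sing_genus1_coef (b := b) g k) 0) => [->|nz].
    by rewrite mul0r !mulr0 mul0r if_same.
  by rewrite -(genus1_sing_basis i gc kc nz) gB mulrA.
rewrite exchange_big; apply: eq_bigr => k _ /=.
by case: ifP => _; [rewrite mulr_suml | rewrite mul0r big1].
Qed.

End Cone.
End Singular.

(** * The complex as a mapping cone *)

Section ConeMaps.
Variables (D : sing_diagram) (b : vtx D).
Hypothesis hb : kind b = Double.
Variable j : int.
Let Dm := resolve b Negative.
Let Dp := resolve b Positive.
Implicit Types (P Q R : {set vtx D}) (x y z : gen D).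

Lemma neg_notin i P x : sing_basis (D := Dm) i j (P, x) -> b \notin P.
Proof.
by case/andP=> + _; rewrite double_points_neg; apply: contraL => bP;
  apply/negP=> /subsetP/(_ b bP); rewrite !inE eqxx.
Qed.

Lemma pos_notin i P x : sing_basis (D := Dp) i j (P, x) -> b \notin P.
Proof.
by case/andP=> + _; rewrite double_points_pos; apply: contraL => bP;
  apply/negP=> /subsetP/(_ b bP); rewrite !inE eqxx.
Qed.

Lemma sing_basis_pos i P x : b \notin P ->
  sing_basis (D := D) i j (b |: P, x) = sing_basis (D := Dp) i j (P, x).
Proof.
move=> bP; rewrite /sing_basis double_points_pos.
have -> : (b |: P \subset double_points D) = (P \subset double_points D :\ b).
  by rewrite subUset sub1set b_double //= subsetD1 bP andbT.
congr (_ && _).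
have -> : double_points D :\: (b |: P) = double_points D :\ b :\: P.
  by rewrite setDDl.
by have := resolved_sign_pos hb P; rewrite /resolved_sign /resolve_all => ->.
Qed.

Lemma sing_basis_neg i k P x : k = i + 1 -> b \notin P ->
  sing_basis (D := D) i j (P, x) = sing_basis (D := Dm) k j (P, x).
Proof.
move=> -> bP; rewrite /sing_basis double_points_neg subsetD1 bP andbT;
  congr (_ && _).
have -> : i + #|double_points D :\: P|%:Z = i + 1
  + #|double_points D :\ b :\: P|%:Z.
  have -> : double_points D :\ b :\: P = (double_points D :\: P) :\ b.
    by rewrite setDDl setUC -setDDl.
  rewrite (cardsD1 b (_ :\: _)) in_setD b_double // bP /=; lia.
by have := resolved_sign_neg hb bP; rewrite /resolved_sign /resolve_all => ->.
Qed.

(** The summands of C(D) are C(D_+) in the same degree and C(D_-) in the next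
    one.  The next degree is an argument [k], equal to [i + 1] by hypothesis,
    since degrees such as [i] and [i - 1 + 1] are equal but not convertible. *)
Definition cone_in i : 'Hom(chain Dp i j, chain D i j) :=
  @pull (sing_gen D) (@sing_basis Dp i j) (@sing_basis D i j)
    (fun g => b \in g.1) (fun g => (g.1 :\ b, g.2)).

Definition cone_ret i : 'Hom(chain D i j, chain Dp i j) :=
  @pull (sing_gen D) (@sing_basis D i j) (@sing_basis Dp i j)
    (fun g => b \notin g.1) (fun g => (b |: g.1, g.2)).

Definition cone_out i k : 'Hom(chain D i j, chain Dm k j) :=
  @pull (sing_gen D) (@sing_basis D i j) (@sing_basis Dm k j)
    (fun g => b \notin g.1) id.

Definition cone_sec i k : 'Hom(chain Dm k j, chain D i j) :=
  @pull (sing_gen D) (@sing_basis Dm k j) (@sing_basis D i j)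
    (fun g => b \notin g.1) id.

Lemma coord_neg_in i (u : chain Dm i j) P x : b \in P -> coord u (P, x) = 0.
Proof.
by move=> bP; rewrite coord_out //; apply/negP=> /neg_notin; rewrite bP.
Qed.

Lemma coord_cone_in i (u : chain Dp i j) P x :
  coord (cone_in i u) (P, x) = if b \in P then coord u (P :\ b, x) else 0.
Proof.
rewrite coord_pull /=; case: (boolP (b \in P)) => bP; last by rewrite andbF.
have e : sing_basis (D := D) i j (P, x) = sing_basis (D := Dp) i j (P :\ b, x).
  by rewrite -sing_basis_pos ?setD11 // setD1K.
rewrite andbT; case: ifP => // /negbT h; rewrite coord_out //.
by apply: contraNN h => h; exact: (etrans e h).
Qed.

Lemma coord_cone_ret i (u : chain D i j) P x :
  coord (cone_ret i u) (P, x) = if b \in P then 0 else coord u (b |: P, x).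
Proof.
rewrite coord_pull /=; case: (boolP (b \in P)) => bP; first by rewrite andbF.
rewrite andbT; case: ifP => // /negbT h; rewrite coord_out //.
by apply: contraNN h => h; exact: (etrans (esym (sing_basis_pos i x bP)) h).
Qed.

Lemma coord_cone_out i k (u : chain D i j) P x : k = i + 1 ->
  coord (cone_out i k u) (P, x) = if b \in P then 0 else coord u (P, x).
Proof.
move=> kE; rewrite coord_pull /=.
case: (boolP (b \in P)) => bP; first by rewrite andbF.
rewrite andbT; case: ifP => // /negbT h; rewrite coord_out //.
by apply: contraNN h => h; exact: (etrans (esym (sing_basis_neg x kE bP)) h).
Qed.

Lemma coord_cone_sec i k (u : chain Dm k j) P x : k = i + 1 ->
  coord (cone_sec i k u) (P, x) = coord u (P, x).
Proof.
move=> kE; rewrite coord_pull /=.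
case: (boolP (b \in P)) => bP; first by rewrite andbF coord_neg_in.
rewrite andbT; case: ifP => // /negbT h; rewrite coord_out //.
by apply: contraNN h => h; exact: (etrans (sing_basis_neg x kE bP) h).
Qed.

Lemma cone_ret_in i (u : chain Dp i j) : cone_ret i (cone_in i u) = u.
Proof.
apply: coord_inj => -[P x] h; have bP := pos_notin h.
by rewrite coord_cone_ret coord_cone_in setU11 setU1K // (negPf bP).
Qed.

Lemma cone_out_in i k (u : chain Dp i j) :
  k = i + 1 -> cone_out i k (cone_in i u) = 0.
Proof.
move=> kE; apply: coord_inj => -[P x] h; have bP := neg_notin h.
by rewrite coord_cone_out // coord_cone_in (negPf bP) coord0.
Qed.

Lemma cone_ret_sec i k (u : chain Dm k j) :
  k = i + 1 -> cone_ret i (cone_sec i k u) = 0.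
Proof.
move=> kE; apply: coord_inj => -[P x] h; have bP := pos_notin h.
by rewrite coord_cone_ret coord_cone_sec // coord_neg_in ?setU11 // coord0
  if_same.
Qed.

Lemma cone_out_sec i k (u : chain Dm k j) :
  k = i + 1 -> cone_out i k (cone_sec i k u) = u.
Proof.
move=> kE; apply: coord_inj => -[P x] h; have bP := neg_notin h.
by rewrite coord_cone_out // coord_cone_sec // (negPf bP).
Qed.

Lemma cone_inj i k (u v : chain D i j) : k = i + 1 ->
  cone_ret i u = cone_ret i v -> cone_out i k u = cone_out i k v -> u = v.
Proof.
move=> kE er eo; apply: coord_inj => -[P x] h.
case: (boolP (b \in P)) => bP.
  have := congr1 (fun u => coord u (P :\ b, x)) er.
  by rewrite /= !coord_cone_ret setD11 setD1K.
have := congr1 (fun u => coord u (P, x)) eo.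
by rewrite /= !coord_cone_out // (negPf bP).
Qed.

Definition cone_splitting i k (kE : k = i + 1) :
    splitting (chain Dp i j) (chain Dm k j) (chain D i j) :=
  Splitting (@cone_ret_in i) (fun u => @cone_out_in i k u kE)
    (fun u => @cone_ret_sec i k u kE) (fun u => @cone_out_sec i k u kE)
    (fun u v => @cone_inj i k u v kE).

(** The four blocks of the differential of C(D), according to whether the
    resolutions of the source and of the target make [b] positive. *)
Lemma diff_in_out R x P z : b \in R -> b \notin P ->
  sing_diff_coef (D := D) (R, x) (P, z) = 0.
Proof.
move=> bR bP; rewrite sing_diff_coefE /=; case: eqP => [e|_].
  by rewrite -e (negPf bP) in bR.
rewrite mul0r add0r big1 // => v /andP[_ /eqP e].
by rewrite e !inE bR orbT in bP.
Qed.

Lemma diff_out_out R x P z : b \notin R -> b \notin P ->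
  sing_diff_coef (D := D) (R, x) (P, z) = sing_diff_coef (D := Dm) (R, x) (P,
    z).
Proof.
move=> bR bP; rewrite !sing_diff_coefE /= resolved_sign_neg //
  double_points_neg; congr (_ + _).
apply: eq_bigl => v; rewrite !inE; case: (eqVneq v b) => [->|//].
rewrite andbF /=; case: eqP => [e|]; last by rewrite andbF.
by rewrite e setU11 in bP.
Qed.

Lemma setU1_eq R P : b \notin R -> b \notin P -> (b |: P == b |: R) = (P == R).
Proof.
move=> bR bP; apply/eqP/eqP => [e|->//].
by rewrite -(setU1K bP) e setU1K.
Qed.

Lemma diff_in_in R x P z : b \notin R -> b \notin P ->
  sing_diff_coef (D := D) (b |: R, x) (b |: P, z)
  = sing_diff_coef (D := Dp) (R, x) (P, z).
Proof.
move=> bR bP; rewrite !sing_diff_coefE /= resolved_sign_pos //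
  double_points_pos setU1_eq //.
rewrite -setDDl; congr (_ + _).
apply: eq_bigl => v; rewrite !inE setUCA; case: (eqVneq v b) => [->|vb].
  by rewrite !andbF.
by rewrite setU1_eq // !inE negb_or eq_sym vb.
Qed.

Lemma diff_out_in R x P z : b \notin R -> b \notin P ->
  sing_diff_coef (D := D) (R, x) (b |: P, z)
  = sing_genus1_coef (b := b) (R, x) (P, z).
Proof.
move=> bR bP; rewrite sing_diff_coefE sing_genus1_coefE /= resolved_sign_neg //.
have -> : (b |: P == R) = false by apply/eqP=> e; rewrite -e setU11 in bR.
rewrite mul0r add0r; case: (eqVneq P R) => [->|nPR].
  rewrite mul1r (big_pred1 b) // => v /=.
  rewrite in_setD; apply/andP/eqP => [[_ /eqP e]|->].
    by move: (setU11 b R); rewrite e in_setU1 (negPf bR) orbF eq_sym => /eqP.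
  by rewrite bR b_double.
rewrite mul0r big1 // => v /andP[_ /eqP e].
have bv : b = v.
  by move: (setU11 b P); rewrite e in_setU1 (negPf bR) orbF => /eqP.
by move: nPR; rewrite -setU1_eq // e bv eqxx.
Qed.

Lemma sum_sing_gen_split (F : sing_gen D -> 'F_2) :
  \sum_g F g = \sum_(R : {set vtx D} | b \notin R) \sum_x F (R, x)
             + \sum_(R : {set vtx D} | b \notin R) \sum_x F (b |: R, x).
Proof.
have -> : \sum_g F g = \sum_(R : {set vtx D}) \sum_(x : gen D) F (R, x).
  by rewrite pair_bigA; apply: eq_bigr => -[].
rewrite (bigID (fun R : {set vtx D} => b \notin R)) /=; congr (_ + _).
rewrite (reindex_onto (fun R => b |: R) (fun R => R :\ b)) /=; last first.
  by move=> R; rewrite negbK; apply: setD1K.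
apply: eq_bigl => R; rewrite setU11 /=; apply/eqP/idP => [<-|/setU1K//].
by rewrite setD11.
Qed.

Lemma cone_out_differential i i' k k' (u : chain D i j) :
  k = i + 1 -> k' = i' + 1 ->
  cone_out i' k' (differential D j i i' u)
  = differential Dm j k k' (cone_out i k u).
Proof.
move=> e e'; apply: coord_inj => -[P z] h; have bP := neg_notin h.
rewrite coord_cone_out // (negPf bP) !coord_differential h.
rewrite (sing_basis_neg _ e') // h !sum_sing_gen_split; congr (_ + _).
  apply: eq_bigr => R bR; apply: eq_bigr => x _.
  by rewrite coord_cone_out // (negPf bR) diff_out_out.
apply: eq_bigr => R bR; apply: eq_bigr => x _.
by rewrite coord_cone_out // setU11 diff_in_out ?setU11 // mulr0 mul0r.
Qed.

Lemma cone_ret_differential i k (u : chain D i j) : k = i + 1 ->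
  cone_ret k (differential D j i k u)
  = differential Dp j i k (cone_ret i u) + genus1_map b k j (cone_out i k u).
Proof.
move=> e; apply: coord_inj => -[P z] h; have bP := pos_notin h.
rewrite coord_cone_ret (negPf bP) coordD !coord_differential.
rewrite coord_genus1_map h sing_basis_pos // h -big_split /=.
rewrite !sum_sing_gen_split -!big_split /=; apply: eq_bigr => R bR.
rewrite -!big_split /=; apply: eq_bigr => x _.
rewrite !coord_cone_ret !coord_cone_out // (negPf bR) setU11 !mul0r !addr0.
rewrite [RHS]addrC.
by congr (_ * _ + _ * _); [exact: diff_out_in | exact: diff_in_in].
Qed.

Lemma cone_differentialP i k k' (kE : k = i + 1) (kE' : k' = k + 1) :
  cone_differential (cone_splitting kE) (cone_splitting kE')
    (differential Dp j i k) (differential Dm j k k') (genus1_map b k j)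
    (differential D j i k).
Proof.
by move=> u; split; [exact: cone_ret_differential | exact:
  cone_out_differential].
Qed.

Lemma genus1_map_cycle i (v : chain Dm i j) :
  differential Dm j i (i + 1) v = 0 ->
  differential Dp j i (i + 1) (genus1_map b i j v) = 0.
Proof. by move=> v0; rewrite -genus1_map_chain v0 linear0. Qed.

Lemma genus1_map_boundary i (u : chain Dm (i - 1) j) :
  exists u' : chain Dp (i - 1) j, differential Dp j (i - 1) i u'
    = genus1_map b i j (differential Dm j (i - 1) i u).
Proof. by exists (genus1_map b (i - 1) j u); rewrite genus1_map_chain. Qed.

Lemma cone_in_cycle i (v : chain Dp i j) :
  differential Dp j i (i + 1) v = 0 ->
  differential D j i (i + 1) (cone_in i v) = 0.
Proof. exact: split_in_cycle (cone_differentialP erefl erefl) v. Qed.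

Lemma cone_in_boundary i (u : chain Dp (i - 1) j) :
  exists u' : chain D (i - 1) j, differential D j (i - 1) i u'
    = cone_in i (differential Dp j (i - 1) i u).
Proof.
have ei : i = i - 1 + 1 by rewrite subrK.
exists (cone_in (i - 1) u).
exact: split_in_boundary (cone_differentialP ei erefl) u.
Qed.

Lemma cone_out_cycle i (v : chain D i j) :
  differential D j i (i + 1) v = 0 ->
  differential Dm j (i + 1) (i + 1 + 1) (cone_out i (i + 1) v) = 0.
Proof. exact: split_out_cycle (cone_differentialP erefl erefl) v. Qed.

Lemma cone_out_boundary i (u : chain D (i - 1) j) :
  exists u' : chain Dm (i + 1 - 1) j, differential Dm j (i + 1 - 1) (i + 1) u'
    = cone_out i (i + 1) (differential D j (i - 1) i u).
Proof.
exists (cone_out (i - 1) (i + 1 - 1) u).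
by rewrite -(@cone_out_differential (i - 1) i) //; lia.
Qed.

End ConeMaps.

Theorem theorem2 (D : sing_diagram) (b : vtx D) (hb : kind b = Double)
    (j : int) :
  let Dm := resolve b Negative in
  let Dp := resolve b Positive in
  exists (Phi : forall i : int, {linear Kh Dm i j -> Kh Dp i j})
         (inc : forall i : int, {linear Kh Dp i j -> Kh D i j})
         (del : forall i : int, {linear Kh D i j -> Kh Dm (i + 1) j}),
    (forall i : int, induced_by (genus1_map b i j) (Phi i)) /\
    (forall i : int,
       [/\ exact_at (Phi i) (inc i),
           exact_at (inc i) (del i)
         & exact_at (del i) (Phi (i + 1))]).
Proof.
move=> Dm Dp.
exists (fun i => induced_map (@genus1_map_cycle D b j i)
                             (@genus1_map_boundary D b j i)).
exists (fun i => induced_map (@cone_in_cycle D b hb j i)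
                             (@cone_in_boundary D b hb j i)).
exists (fun i => induced_map (@cone_out_cycle D b hb j i)
                             (@cone_out_boundary D b hb j i)).
split=> i; first exact: induced_mapP.
have ei : i = i - 1 + 1 by rewrite subrK.
have cone0 := @cone_differentialP D b hb j _ _ _ ei (erefl (i + 1)).
have cone1 := @cone_differentialP D b hb j _ _ _ (erefl (i + 1)) (erefl (i
  + 1 + 1)).
have phi_chain := @genus1_map_chain D b j i (i + 1).
split; apply: (exact_induced (induced_mapP _ _) (induced_mapP _ _)).
- by move=> v _; exact: (cone_exact_pos cone0).
- move=> v v0; have := cone_exact_cone phi_chain cone0 cone1 v0.
  by move: (i + 1 - 1) (addrK 1 i) => k ->.
(* both sides speak of the degree i, written i + 1 - 1 as the degree before
   i + 1 *)
move=> y y0; have := cone_exact_neg phi_chain cone1 y0.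
by move: (i + 1 - 1) (addrK 1 i) => k ->.
Qed.
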